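(* Let $(M:=\Gamma\backslash G,I,J,K,g)$ be a $4n$-dimensional solvmanifold with an invariant (nowhere vanishing) holomorphic section of the canonical bundle of $(M,I)$ and with an invariant HKT structure $(I,J,K,g)$. Then $g$ is balanced.
   Context: A solvmanifold is a compact quotient $\Gamma\backslash G$ of a simply connected solvable Lie group $G$ by a lattice $\Gamma$. Tensors on $\Gamma\backslash G$ are invariant if they are induced by left-invariant tensors on $G$. A hypercomplex structure $(I,J,K)$ consists of three integrable complex structures that pairwise anticommute with $IJ=K$. The canonical bundle is the bundle of $(2n,0)$-forms with respect to $I$. An HKT structure $(I,J,K,g)$ is a hypercomplex structure together with a Riemannian metric $g$, Hermitian with respect to $I,J,K$, whose associated $(2,0)$-form (with respect to $I$) $\Omega:=\frac12\big(g(J\cdot,\cdot)+i\,g(K\cdot,\cdot)\big)$ satisfies $\partial\Omega=0$, with $\partial$ the $(1,0)$-Dolbeault operator of $I$. It is invariant if $I,J,K,g$ are invariant. $g$ is balanced if $(M,I,g)$ is balanced, i.e. the fundamental form $\omega_I$ of $(I,g)$ satisfies $d\omega_I^{2n-1}=0$ (equivalently, for compact HKT manifolds, $\partial\bar\Omega^n=0$). *)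

(* Defs.v *)
From HB Require Import structures.
From mathcomp Require Import all_boot all_order all_algebra perm.
From mathcomp Require Import complex.
From mathcomp Require Import all_classical all_reals all_analysis.
Import Order.TTheory GRing.Theory Num.Theory.
Import numFieldNormedType.Exports.

Set Implicit Arguments.
Unset Strict Implicit.
Unset Printing Implicit Defensive.

Local Open Scope classical_set_scope.
Local Open Scope ring_scope.

(* Vectors are rows and linear maps act on the right: the endomorphism with   *)
(* matrix E sends v to v *m E, so that E *m F is the composite "E, then F",   *)
(* in agreement with 'J f x, for which 'd f x v = v *m 'J f x. In particular  *)
(* the identity IJ = K between endomorphisms reads  J *m I = K.               *)

Section Calculus.
Context {R : realType}.

(* On an open set U: infinitely differentiable. *)
Definition smooth_on {m k : nat} (U : set 'rV[R]_m) (f : 'rV[R]_m -> 'rV[R]_k) :=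
  forall (l : seq 'rV[R]_m) x, U x ->
    differentiable (foldr (fun v h y => 'D_v h y) f l) x.

Definition smooth_fun_on {m : nat} (U : set 'rV[R]_m) (f : 'rV[R]_m -> R) :=
  smooth_on U (fun x => \row_(_ < 1) f x).

Definition vbracket {m : nat} (X Y : 'rV[R]_m -> 'rV[R]_m) : 'rV[R]_m -> 'rV[R]_m :=
  fun x => 'D_(X x) Y x - 'D_(Y x) X x.

(* N_E(u, v) at x, computed on the constant extensions of u and v. *)
Definition nijenhuis {m : nat} (E : 'rV[R]_m -> 'M[R]_m) (x u v : 'rV[R]_m) :=
  let EX w := fun y => w *m E y in
  vbracket (EX u) (EX v) x - vbracket (EX u) (cst v) x *m E x
  - vbracket (cst u) (EX v) x *m E x - vbracket (cst u) (cst v) x.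

End Calculus.

Section Forms.
Context {R : realType} {m : nat}.
Local Notation C := R[i].

Definition cmx {p q : nat} (A : 'M[R]_(p, q)) : 'M[C]_(p, q) := map_mx (real_complex R) A.

(* Complex-valued k-covectors, evaluated on k-tuples of complexified tangent  *)
(* vectors: the arguments are the rows of a matrix.                           *)
Definition form (k : nat) := 'M[C]_(k, m) -> C.

Definition multilinear k (a : form k) :=
  forall (i : 'I_k) (A B D : 'M[C]_(k, m)) (b d : C),
    row i A = b *: row i B + d *: row i D ->
    row' i B = row' i A -> row' i D = row' i A ->
    a A = b * a B + d * a D.

Definition alternating k (a : form k) :=
  forall (A : 'M[C]_(k, m)) (i j : 'I_k), i != j -> row i A = row j A -> a A = 0.

Definition bilinear_form (B : 'M[C]_m) : form 2 :=
  fun A => (row ord0 A *m B *m (row ord_max A)^T) ord0 ord0.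

Definition wedge p q (a : form p) (b : form q) : form (p + q) :=
  fun A => ((p`! * q`!)%N%:R)^-1 *
    \sum_(s : 'S_(p + q))
      (-1) ^+ s * (a (usubmx (row_perm s A)) * b (dsubmx (row_perm s A))).

Fixpoint wedge_pow (w : form 2) (k : nat) : form k.*2 :=
  match k return form k.*2 with
  | 0 => fun _ => 1
  | k'.+1 => wedge w (@wedge_pow w k')
  end.

(* Projections of the complexified tangent space onto the i and -i            *)
(* eigenspaces of E.                                                          *)
Definition proj10 (E : 'M[R]_m) (v : 'rV[C]_m) : 'rV[C]_m :=
  2^-1 *: (v - 'i%C *: (v *m cmx E)).
Definition proj01 (E : 'M[R]_m) (v : 'rV[C]_m) : 'rV[C]_m :=
  2^-1 *: (v + 'i%C *: (v *m cmx E)).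

(* The (p, k - p) component of a k-covector with respect to E: expand each    *)
(* argument as v = v^{1,0} + v^{0,1} and keep the terms with p factors        *)
(* v^{1,0}.                                                                   *)
Definition type_part (E : 'M[R]_m) (p : nat) k (a : form k) : form k :=
  fun A => \sum_(S : {set 'I_k} | #|S| == p)
    a (\matrix_(r < k) (if r \in S then proj10 E (row r A) else proj01 E (row r A))).

Definition Re_fun (f : 'rV[R]_m -> C) : 'rV[R]_m -> R := fun x => complex.Re (f x).
Definition Im_fun (f : 'rV[R]_m -> C) : 'rV[R]_m -> R := fun x => complex.Im (f x).

(* Derivative of a complex-valued function along a complexified vector. *)
Definition cderive (f : 'rV[R]_m -> C) (x : 'rV[R]_m) (w : 'rV[C]_m) : C :=
  \sum_(j < m) w ord0 j *
    ('D_(delta_mx ord0 j) (Re_fun f) x +i* 'D_(delta_mx ord0 j) (Im_fun f) x)%C.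

Definition extd k (a : 'rV[R]_m -> form k) : 'rV[R]_m -> form k.+1 :=
  fun x A => \sum_(r < k.+1)
    (-1) ^+ r * cderive (fun y => a y (row' r A)) x (row r A).

End Forms.
Arguments form : clear implicits.
Arguments wedge_pow {R m} w k _.

Section Manifolds.
Context {R : realType} {m : nat}.

Record manifold_on (T : topologicalType) := ManifoldOn {
  chart : Type;
  dom : chart -> set T;
  crd : chart -> T -> 'rV[R]_m;
  par : chart -> 'rV[R]_m -> T;
  crng := fun c => crd c @` dom c;
  dom_open : forall c, open (dom c);
  crng_open : forall c, open (crng c);
  dom_cover : forall p, exists c, dom c p;
  crdK : forall c p, dom c p -> par c (crd c p) = p;
  crd_continuous : forall c, {in dom c, continuous (crd c)};
  par_continuous : forall c, {in crng c, continuous (par c)};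
  transition_smooth : forall c c',
    smooth_on (crd c @` (dom c `&` dom c')) (crd c' \o par c);
  manifold_hausdorff : hausdorff_space T;
  manifold_second_countable : @second_countable T
}.

End Manifolds.
Arguments manifold_on : clear implicits.
Arguments chart {R m T}.
Arguments dom {R m T} _ _ _.
Arguments crd {R m T} _ _ _.
Arguments par {R m T} _ _ _.
Arguments crng {R m T} _ _ _.

Section SmoothMaps.
Context {R : realType} {m : nat} {T T' : topologicalType}.
Variables (X : manifold_on R m T) (Y : manifold_on R m T').

Definition local_expr (f : T -> T') (c : chart X) (c' : chart Y) :
  'rV[R]_m -> 'rV[R]_m := crd Y c' \o f \o par X c.

Definition smooth_map (f : T -> T') :=
  continuous f /\
  forall c c', smooth_on (crd X c @` (dom X c `&` f @^-1` dom Y c'))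
                         (local_expr f c c').

(* Matrix of the differential of f at p in the charts c and c'. *)
Definition tangent_map (f : T -> T') (c : chart X) (c' : chart Y) (p : T) : 'M[R]_m :=
  'J (local_expr f c c') (crd X c p).

Definition local_diffeo (f : T -> T') :=
  smooth_map f /\
  forall p c c', dom X c p -> dom Y c' (f p) -> tangent_map f c c' p \in unitmx.

End SmoothMaps.

(* A kind of tensor: the values at a point in coordinates, the algebraic      *)
(* condition on these values, when t is the pullback of t' by the linear map  *)
(* with matrix D (for endomorphisms: t and t' are D-related), and smoothness  *)
(* of a coordinate expression.                                                *)
Record tensor_kind (R : realType) (m : nat) := TensorKind {
  value : Type;
  valid : value -> Prop;
  pulled : 'M[R]_m -> value -> value -> Prop;
  smooth_expr : set 'rV[R]_m -> ('rV[R]_m -> value) -> Prop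
}.
Arguments value {R m} _.
Arguments valid {R m} _ _.
Arguments pulled {R m} _ _ _ _.
Arguments smooth_expr {R m} _ _ _.

Definition endo_kind (R : realType) (m : nat) : tensor_kind R m :=
  @TensorKind R m 'M[R]_m (fun=> True)
    (fun D E E' => E *m D = D *m E')
    (fun U E => forall i j, smooth_fun_on U (fun x => E x i j)).

Definition bilinear_kind (R : realType) (m : nat) : tensor_kind R m :=
  @TensorKind R m 'M[R]_m (fun=> True)
    (fun D g g' => g = D *m g' *m D^T)
    (fun U g => forall i j, smooth_fun_on U (fun x => g x i j)).

Definition form_kind (R : realType) (m k : nat) : tensor_kind R m :=
  @TensorKind R m (form R m k) (fun a => multilinear a /\ alternating a)
    (fun D a a' => forall A, a A = a' (A *m cmx D))
    (fun U a => forall A, smooth_fun_on U (Re_fun (fun x => a x A)) /\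
                          smooth_fun_on U (Im_fun (fun x => a x A))).

Section Tensors.
Context {R : realType} {m : nat} (k : tensor_kind R m).

(* Coordinate expressions, one per chart; only the values on crng X c matter. *)
Definition field {T : topologicalType} (X : manifold_on R m T) :=
  chart X -> 'rV[R]_m -> value k.

Definition pullback_field {T T' : topologicalType} {X : manifold_on R m T}
    {Y : manifold_on R m T'} (f : T -> T') (t : field X) (t' : field Y) :=
  forall p c c', dom X c p -> dom Y c' (f p) ->
    pulled k (tangent_map f c c' p) (t c (crd X c p)) (t' c' (crd Y c' (f p))).

Definition tensor_field {T : topologicalType} {X : manifold_on R m T} (t : field X) :=
  [/\ forall c x, crng X c x -> valid k (t c x),
      forall c, smooth_expr k (crng X c) (t c)
    & pullback_field id t t].

End Tensors.
Arguments field {R m} k {T} X.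

Section Groups.
Context {G : groupType}.
Local Open Scope group_scope.

Definition is_subgroup (H : set G) :=
  H 1 /\ forall x y, H x -> H y -> H (x * y^-1).

Definition generated (A : set G) : set G :=
  \bigcap_(H in [set H | is_subgroup H /\ A `<=` H]) H.

Definition derived_subgroup (H : set G) : set G :=
  generated [set z | exists x y, [/\ H x, H y & z = [~ x, y]]].

Definition solvable_group := exists k, iter k derived_subgroup setT = [set 1].

End Groups.
Arguments solvable_group : clear implicits.

#[short(type="topGroupType")]
HB.structure Definition TopGroup := {G of Group G & Topological G}.

Section LieGroups.
Context {R : realType} {m : nat} {G : topGroupType}.
Variable X : manifold_on R m G.
Local Open Scope group_scope.

Definition smooth_mul :=
  continuous (fun z : G * G => z.1 * z.2) /\
  forall a b c : chart X,
    smooth_on [set z : 'rV[R]_(m + m) |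
        [/\ crng X a (lsubmx z), crng X b (rsubmx z)
          & dom X c (par X a (lsubmx z) * par X b (rsubmx z))]]
      (fun z => crd X c (par X a (lsubmx z) * par X b (rsubmx z))).

Definition lie_group := smooth_mul /\ smooth_map X X (fun x : G => x^-1).

Definition left_invariant_tensor (k : tensor_kind R m) (t : field k X) :=
  tensor_field t /\ forall h : G, pullback_field (fun x => h * x) t t.

Definition discrete_subgroup (Gamma : set G) :=
  is_subgroup Gamma /\ exists2 U, nbhs (1 : G) U & U `&` Gamma = [set 1].

End LieGroups.

Definition simply_connected (R : realType) (T : topologicalType) :=
  let U : set R := `[0, 1]%classic in
  (forall x y : T, exists f : R -> T,
     [/\ {within U, continuous f}, f 0 = x & f 1 = y]) /\
  (forall f : R -> T, {within U, continuous f} -> f 0 = f 1 ->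
     exists H : R * R -> T,
     [/\ {within U `*` U, continuous H},
         forall t, U t -> H (0, t) = f t /\ H (1, t) = f 0
       & forall s, U s -> H (s, 0) = f 0 /\ H (s, 1) = f 0]).

Section Solvmanifolds.
Context {R : realType} {m : nat} {G : topGroupType} {T : topologicalType}.
Variables (X : manifold_on R m G) (Gamma : set G).
Variables (M : manifold_on R m T) (pi : G -> T).
Local Open Scope group_scope.

(* M is the quotient manifold Gamma \ G with projection pi, whose fibres are  *)
(* the cosets Gamma x.                                                        *)
Definition solvmanifold :=
  [/\ lie_group X, simply_connected R G, solvable_group G, discrete_subgroup Gamma
    & [/\ forall y, exists x, pi x = y,
          forall x y, pi x = pi y <-> exists2 h, Gamma h & y = h * x,
          local_diffeo X M pi
        & compact [set: T]]].

Definition invariant_tensor (k : tensor_kind R m) (t : field k M) :=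
  tensor_field t /\ exists2 t', @left_invariant_tensor R m G X k t' & pullback_field pi t' t.

End Solvmanifolds.
Arguments invariant_tensor {R m G T} X {M} pi {k} t.

Section HKT.
Context {R : realType} {m : nat} {T : topologicalType} {M : manifold_on R m T}.

Definition everywhere (P : chart M -> 'rV[R]_m -> Prop) :=
  forall c x, crng M c x -> P c x.

Definition zero_form k (a : field (form_kind R m k) M) :=
  everywhere (fun c x => forall A, a c x A = 0).

Definition ext_deriv k (a : field (form_kind R m k) M) : field (form_kind R m k.+1) M :=
  fun c => extd (a c).

Section Dolbeault.
Variable E : field (endo_kind R m) M.

Definition has_type (p : nat) k (a : field (form_kind R m k) M) :=
  everywhere (fun c x => forall A, a c x A = type_part (E c x) p (a c x) A).

(* For a of type (p, k - p). *)
Definition del (p : nat) k (a : field (form_kind R m k) M) : field (form_kind R m k.+1) M :=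
  fun c x => type_part (E c x) p.+1 (ext_deriv a c x).
Definition delbar (p : nat) k (a : field (form_kind R m k) M) : field (form_kind R m k.+1) M :=
  fun c x => type_part (E c x) p (ext_deriv a c x).

(* Smooth sections of the bundle of (q, 0)-forms. *)
Definition section_q0 (q : nat) (a : field (form_kind R m q) M) :=
  tensor_field a /\ has_type q a.

Definition nowhere_vanishing k (a : field (form_kind R m k) M) :=
  everywhere (fun c x => exists A, a c x A <> 0).

Definition integrable_complex_structure :=
  [/\ tensor_field E,
      everywhere (fun c x => E c x *m E c x = - 1%:M)
    & everywhere (fun c x => forall u v, nijenhuis (E c) x u v = 0)].

Definition hermitian (g : field (bilinear_kind R m) M) :=
  everywhere (fun c x => E c x *m g c x *m (E c x)^T = g c x).

Definition fundamental_form (g : field (bilinear_kind R m) M) :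
    field (form_kind R m 2) M :=
  fun c x => bilinear_form (cmx (E c x *m g c x)).

(* q is the complex dimension. *)
Definition balanced (q : nat) (g : field (bilinear_kind R m) M) :=
  zero_form (ext_deriv (fun c x => wedge_pow (fundamental_form g c x) q.-1)).

End Dolbeault.

Definition riemannian (g : field (bilinear_kind R m) M) :=
  [/\ tensor_field g,
      everywhere (fun c x => (g c x)^T = g c x)
    & everywhere (fun c x => forall v : 'rV[R]_m, v != 0 ->
        0 < (v *m g c x *m v^T) ord0 ord0)].

Definition hypercomplex (I J K : field (endo_kind R m) M) :=
  [/\ integrable_complex_structure I, integrable_complex_structure J,
      integrable_complex_structure K,
      everywhere (fun c x => J c x *m I c x = K c x)
    & everywhere (fun c x => [/\ I c x *m J c x = - (J c x *m I c x),
                                 J c x *m K c x = - (K c x *m J c x)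
                               & K c x *m I c x = - (I c x *m K c x)])].

(* (g(J., .) + i g(K., .)) / 2 *)
Definition hkt_form (J K : field (endo_kind R m) M) (g : field (bilinear_kind R m) M) :
    field (form_kind R m 2) M :=
  fun c x => bilinear_form
    (2^-1 *: (cmx (J c x *m g c x) + 'i%C *: cmx (K c x *m g c x))).

Definition HKT (I J K : field (endo_kind R m) M) (g : field (bilinear_kind R m) M) :=
  [/\ hypercomplex I J K, riemannian g,
      [/\ hermitian I g, hermitian J g & hermitian K g]
    & zero_form (del I 2 (hkt_form J K g))].

Definition holomorphic_canonical_section (I : field (endo_kind R m) M) (q : nat)
    (Theta : field (form_kind R m q) M) :=
  section_q0 I Theta /\ zero_form (delbar I q Theta).

End HKT.

(* Main.v *)
(* Near a point x, let D be the torsion-free (Obata) connection preserving I,  *)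
(* J, K, put X = (D g) g^-1 / 2, and consider the connection D + X: it          *)
(* preserves I, J, K and g, hence omega_I, its powers and Omega. As D has no    *)
(* torsion, the exterior derivative of a parallel form involves X only.         *)
(* By homogeneity Theta(A) Theta(B) = c det (A Omega B^T) with the same c at    *)
(* all points (morally, Theta is a constant multiple of Omega^n), hence Theta   *)
(* is parallel for D + X as well, and its being holomorphic means that          *)
(* tr X_u = 0 for all u. The (3,0)-part of d Omega, contracted with the inverse *)
(* of Omega, gives 2 tr (v |-> X_v u) = tr X_u / 2 for u of type (1,0), so that *)
(* the first trace vanishes too. Finally omega_I^(2n-1) is invariant under the  *)
(* symplectic group of omega_I, so that alpha ^ omega_I^(2n-1) is               *)
(* proportional to the contraction of the volume form with the dual vector u of *)
(* alpha; therefore alpha ^ d omega_I^(2n-1) is proportional to the trace of    *)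
(* v |-> X_v u, which is zero.                                                  *)
Require Import Defs.
From mathcomp Require Import all_boot all_order all_algebra perm.
From mathcomp Require Import complex.
From mathcomp Require Import all_classical all_reals all_analysis.
From mathcomp Require Import ring lra zify.
Import Order.TTheory GRing.Theory Num.Theory.
Import numFieldNormedType.Exports.

Set Implicit Arguments.
Unset Strict Implicit.
Unset Printing Implicit Defensive.

(** Apart from one use of homogeneity, the argument takes place at a single point of a chart. There
    [I], [J], [K] and [g] are parallel for a connection [G j + X j], where [G] has no torsion
    ([obata_connection], [hyperhermitian_connection]) and [X] commutes with [I] and [J] and is
    self-adjoint for [g]. The derivatives of a parallel form are the algebraic action [act] of the
    connection, its exterior derivative is [ext] ([extdE]), and [G] drops out of it ([ext_sym]).
    Every differential condition thus becomes a condition on the tensor [X], and in fact on its two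
    traces.

    [Theta] has to be parallel too. At each point a (q,0)-form has square [c det (A Omega B^T)] for
    some constant [c] ([q0_form_gram]); invariance makes [c] the same everywhere
    ([invariant_homogeneous]), and differentiating this identity shows that [Theta] inherits the
    parallelism of [Omega] ([cder_of_gram]).

    Then holomorphy of [Theta] kills the trace of [X_u] ([trace_eq0_of_q0_form]); given this, the
    HKT condition kills the trace of [v |-> X_v u] ([flip_trace_eq0_of_hkt]). When both vanish, the
    power of [omega_I] in complementary degree 2 is closed: the wedge of a 1-form with it is a
    contraction of a volume form, on which endomorphisms act by their trace ([ext_coclosed]). All
    this is assembled in [balanced_in_chart]. *)

Local Open Scope classical_set_scope.
Local Open Scope ring_scope.

(** * Multilinear algebra *)

(* A family X of matrices is a linear map u |-> comb X u into endomorphisms,   *)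
(* the form of a connection; flip exchanges its two vector arguments.          *)
Section Families.
Context {F : fieldType} {m : nat}.
Implicit Types X Y : 'I_m -> 'M[F]_m.

Definition comb X (u : 'rV[F]_m) : 'M[F]_m := \sum_j u 0 j *: X j.

Definition flip X : 'I_m -> 'M[F]_m := fun j => \matrix_(b, c) X b j c.

Definition precomp (A : 'M[F]_m) X : 'I_m -> 'M[F]_m := fun j => comb X (row j A).

Lemma combD X Y u : comb (fun j => X j + Y j) u = comb X u + comb Y u.
Proof. by rewrite /comb -big_split; apply: eq_bigr => j _; rewrite scalerDr. Qed.

Lemma combB X Y u : comb (fun j => X j - Y j) u = comb X u - comb Y u.
Proof. by rewrite /comb -sumrB; apply: eq_bigr => j _; rewrite scalerBr. Qed.

Lemma combZ (c : F) X u : comb (fun j => c *: X j) u = c *: comb X u.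
Proof.
by rewrite /comb scaler_sumr; apply: eq_bigr => j _; rewrite !scalerA mulrC.
Qed.

Lemma comb_mull (A : 'M[F]_m) X u : comb (fun j => A *m X j) u = A *m comb X u.
Proof. by rewrite /comb mulmx_sumr; apply: eq_bigr => j _; rewrite scalemxAr. Qed.

Lemma comb_mulr (A : 'M[F]_m) X u : comb (fun j => X j *m A) u = comb X u *m A.
Proof. by rewrite /comb mulmx_suml; apply: eq_bigr => j _; rewrite scalemxAl. Qed.

Lemma comb_lin X (c d : F) u v : comb X (c *: u + d *: v) = c *: comb X u + d *: comb X v.
Proof.
rewrite /comb !scaler_sumr -big_split; apply: eq_bigr => j _ /=.
by rewrite !mxE scalerDl !scalerA.
Qed.

Lemma combN X u : comb X (- u) = - comb X u.
Proof. by rewrite -scaleN1r -[_ *: u]addr0 -[0](scale0r u) comb_lin scale0r addr0 scaleN1r. Qed.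

Lemma comb_delta X j : comb X (delta_mx 0 j) = X j.
Proof.
rewrite /comb (bigD1 j) //= big1 => [|i ij]; rewrite mxE !eqxx /=.
  by rewrite scale1r addr0.
by rewrite (negbTE ij) scale0r.
Qed.

Lemma comb_precomp A X u : comb (precomp A X) u = comb X (u *m A).
Proof.
rewrite /precomp /comb; under eq_bigr do rewrite scaler_sumr.
rewrite exchange_big; apply: eq_bigr => j _; rewrite mxE scaler_suml.
by apply: eq_bigr => i _; rewrite scalerA mxE.
Qed.

Lemma mul_comb_flip X u v : v *m comb (flip X) u = u *m comb X v.
Proof.
rewrite /comb !mulmx_sumr; apply/rowP=> c; rewrite !summxE.
under eq_bigr do rewrite -scalemxAr !mxE mulr_sumr.
rewrite exchange_big; apply: eq_bigr => b _.
rewrite -scalemxAr !mxE mulr_sumr; apply: eq_bigr => a _.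
by rewrite mxE mulrCA.
Qed.

End Families.

Section MultilinearAlgebra.
Context {R : realType} {m : nat}.
Local Notation C := R[i].
Local Notation form := (Defs.form R m).
Local Notation multilinear := Defs.multilinear.
Local Notation alternating := Defs.alternating.

Lemma eq_opp0 (x : C) : x = - x -> x = 0.
Proof.
by move/eqP; rewrite -addr_eq0 -mulr2n -mulr_natl mulf_eq0 pnatr_eq0 /= => /eqP.
Qed.

Definition upd k (A : 'M[C]_(k, m)) (r : 'I_k) (v : 'rV[C]_m) : 'M[C]_(k, m) :=
  \matrix_(i, j) (if i == r then v 0 j else A i j).

(** The derivation of forms induced by an endomorphism. The sign is such that a form parallel for a
    connection with matrix [Y] has derivative [act Y]. *)
Definition act (Y : 'M[C]_m) k (a : form k) : form k :=
  fun A => \sum_(r < k) a (upd A r (row r A *m Y)).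

Lemma row_upd k (A : 'M[C]_(k, m)) r v : row r (upd A r v) = v.
Proof. by apply/rowP=> j; rewrite !mxE eqxx. Qed.

Lemma row_upd_neq k (A : 'M[C]_(k, m)) r v i : i != r -> row i (upd A r v) = row i A.
Proof. by move=> h; apply/rowP=> j; rewrite !mxE (negbTE h). Qed.

Lemma row'_upd k (A : 'M[C]_(k, m)) r v : row' r (upd A r v) = row' r A.
Proof. by apply/matrixP=> i j; rewrite !mxE eq_sym (negbTE (neq_lift _ _)). Qed.

Lemma upd_row k (A : 'M[C]_(k, m)) r : upd A r (row r A) = A.
Proof. by apply/matrixP=> i j; rewrite !mxE; case: eqP => // ->. Qed.

Lemma upd_upd k (A : 'M[C]_(k, m)) r u v : upd (upd A r u) r v = upd A r v.
Proof. by apply/matrixP=> i j; rewrite !mxE; case: eqP. Qed.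

Lemma updC k (A : 'M[C]_(k, m)) r s u v : r != s ->
  upd (upd A r u) s v = upd (upd A s v) r u.
Proof.
move=> rs; apply/matrixP=> i j; rewrite !mxE.
case: (i =P s) => [->|//].
by rewrite eq_sym (negbTE rs).
Qed.

Lemma upd_eq k (A B : 'M[C]_(k, m)) r : row' r A = row' r B -> upd A r (row r B) = B.
Proof.
move=> h; apply/matrixP=> i j; rewrite !mxE.
case: eqP => [->//|/eqP hi].
case: (unliftP r i) hi => [i' -> _|->]; last by rewrite eqxx.
by move/matrixP: h => /(_ i' j); rewrite !mxE.
Qed.

Lemma multilinear_upd k (a : form k) : multilinear a ->
  forall A r (b d : C) u v,
  a (upd A r (b *: u + d *: v)) = b * a (upd A r u) + d * a (upd A r v).
Proof. by move=> ml A r b d u v; apply: (ml r); rewrite ?row_upd ?row'_upd. Qed.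

Lemma multilinearP k (a : form k) :
  (forall A r (b d : C) u v,
    a (upd A r (b *: u + d *: v)) = b * a (upd A r u) + d * a (upd A r v)) ->
  multilinear a.
Proof.
move=> h r A B D b d hA hB hD.
by rewrite -[in LHS](upd_row A r) hA h !upd_eq.
Qed.

Lemma updD k (a : form k) (ml : multilinear a) A r u v :
  a (upd A r (u + v)) = a (upd A r u) + a (upd A r v).
Proof. by rewrite -[u]scale1r -[v]scale1r multilinear_upd // !mul1r !scale1r. Qed.

Lemma updZ k (a : form k) (ml : multilinear a) A r (b : C) u :
  a (upd A r (b *: u)) = b * a (upd A r u).
Proof.
have := multilinear_upd ml A r b 0 u 0.
by rewrite scaler0 addr0 mul0r addr0.
Qed.

Lemma upd0 k (a : form k) (ml : multilinear a) A r : a (upd A r 0) = 0.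
Proof. by rewrite -(scale0r 0) updZ // mul0r. Qed.

Lemma multilinear_row0 k (a : form k) (ml : multilinear a) A r :
  row r A = 0 -> a A = 0.
Proof. by move=> h; rewrite -(upd_row A r) h upd0. Qed.

Lemma upd_sum k (a : form k) (ml : multilinear a) A r (I : finType) (P : pred I)
    (f : I -> 'rV[C]_m) :
  a (upd A r (\sum_(i | P i) f i)) = \sum_(i | P i) a (upd A r (f i)).
Proof.
apply: (big_ind2 (fun v c => a (upd A r v) = c)) => //; first exact: upd0.
by move=> u c v d <- <-; rewrite updD.
Qed.

Lemma alternating_upd k (a : form k) (al : alternating a) A i j :
  i != j -> a (upd A i (row j A)) = 0.
Proof.
by move=> ij; apply: (al _ i j ij); rewrite row_upd row_upd_neq // eq_sym.
Qed.

Lemma alternating_tperm k (a : form k) (ml : multilinear a) (al : alternating a) A i j :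
  i != j -> a (row_perm (tperm i j) A) = - a A.
Proof.
move=> ij; have ji : j != i by rewrite eq_sym.
pose B u v := upd (upd A i u) j v.
have B0 u : a (B u u) = 0.
  by apply: (al _ i j ij); rewrite row_upd row_upd_neq // row_upd.
have BD u v w : a (B (u + v) w) = a (B u w) + a (B v w).
  by rewrite /B updC // updD // !(updC _ _ _ ij).
have := B0 (row i A + row j A).
rewrite BD /B !updD // -!/(B _ _) !B0 add0r addr0 => /eqP; rewrite addr_eq0.
have -> : B (row i A) (row j A) = A.
  by rewrite /B upd_row upd_row.
have -> : B (row j A) (row i A) = row_perm (tperm i j) A.
  apply/matrixP=> p q; rewrite !mxE.
  case: tpermP => [->|->|/eqP/negbTE-> /eqP/negbTE->//].
    by rewrite (negbTE ij) eqxx.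
  by rewrite eqxx.
by move/eqP->; rewrite opprK.
Qed.

Lemma alternating_perm k (a : form k) (ml : multilinear a) (al : alternating a) A
    (s : 'S_k) : a (row_perm s A) = (-1) ^+ s * a A.
Proof.
have [ts -> tsP] := prod_tpermP s.
elim: ts tsP => [_|[i j] ts IH /= /andP[ij tsP]].
  by rewrite big_nil row_perm1 odd_perm1 mul1r.
rewrite big_cons /= row_permM alternating_tperm //= IH // odd_permM odd_tperm ij.
by rewrite signr_addb expr1 !mulNr mul1r.
Qed.

End MultilinearAlgebra.

(** * Determinants and forms of top degree *)

Section TopForms.
Context {R : realType}.
Local Notation C := R[i].
Local Notation form := (Defs.form R).
Local Notation multilinear := Defs.multilinear.
Local Notation alternating := Defs.alternating.

(** Induction on the number [t] of leading rows not known to be basis vectors: expanding one such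
    row in the standard basis lowers [t]. When all rows are basis vectors, either two coincide or
    the matrix is a row permutation of the identity. *)
Lemma top_form_eq0 k (a : form k k) : multilinear a -> alternating a ->
  a 1%:M = 0 -> forall A, a A = 0.
Proof.
move=> ml al a1.
suff H t : forall (A : 'M[C]_k) (f : 'I_k -> 'I_k),
    (forall i : 'I_k, (t <= i)%N -> row i A = delta_mx 0 (f i)) -> a A = 0.
  by move=> A; apply: (H k A id) => i; rewrite leqNgt ltn_ord.
elim: t => [|t IH] A f Af.
  have [/injectiveP fi|nf] := boolP (injectiveb f).
    have -> : A = row_perm (perm fi) 1%:M.
      apply/row_matrixP=> i; rewrite Af //; apply/rowP=> j.
      by rewrite !mxE permE eqxx eq_sym.
    by rewrite alternating_perm // a1 mulr0.
  have /injectivePn[i [j ij fij]] : ~~ injectiveb f by [].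
  by apply: (al _ _ _ ij); rewrite !Af // fij.
have [tk|kt] := ltnP t k; last first.
  by apply: (IH A f) => i ti; have := leq_trans kt ti; rewrite leqNgt ltn_ord.
pose r := Ordinal tk.
rewrite -(upd_row A r) (row_sum_delta (row r A)) upd_sum // big1 // => j _.
rewrite updZ // (IH _ (fun i => if i == r then j else f i)) ?mulr0 // => i ti.
have [->|ir] := eqVneq i r; first by rewrite row_upd.
by rewrite row_upd_neq // Af // ltn_neqAle ti andbT eq_sym.
Qed.

Lemma upd_mul k p q (M : 'M[C]_(k, p)) (B : 'M[C]_(p, q)) r v :
  upd M r v *m B = upd (M *m B) r (v *m B).
Proof.
apply/row_matrixP=> i; have [->|ir] := eqVneq i r.
  by rewrite row_mul !row_upd.
by rewrite row_mul !row_upd_neq // row_mul.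
Qed.

(** As functions of the rows of [M] both sides are alternating of top degree, so it suffices to
    compare them at the identity. *)
Lemma det_mul_form k p (a : form p k) : multilinear a -> alternating a ->
  forall (M : 'M[C]_k) (B : 'M[C]_(k, p)), a (M *m B) = \det M * a B.
Proof.
move=> ml al M B; apply/eqP; rewrite -subr_eq0; apply/eqP; move: M.
apply: (@top_form_eq0 k (fun M => a (M *m B) - \det M * a B)).
- apply: multilinearP => A r b d u v.
  rewrite (@determinant_multilinear _ _ _ (upd A r u) (upd A r v) r b d)
    ?row_upd ?row'_upd //.
  by rewrite !upd_mul mulmxDl -!scalemxAl multilinear_upd //; ring.
- move=> A i j ij Aij; rewrite (determinant_alternate ij) ?mul0r ?subr0.
    by rewrite (al _ i j ij) // !row_mul Aij.
  by move=> s; move/rowP: Aij => /(_ s); rewrite !mxE.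
- by rewrite mul1mx det1 mul1r subrr.
Qed.

Lemma top_formE k (a : form k k) : multilinear a -> alternating a ->
  forall A, a A = \det A * a 1%:M.
Proof. by move=> ml al A; rewrite -det_mul_form // mulmx1. Qed.

(** Infinitesimal version of [det_mul_form]: when row [r] of [B] is replaced by a combination of
    rows of [B], only the coefficient of row [r] itself survives alternation. *)
Lemma sum_upd_mul k p (a : form p k) : multilinear a -> alternating a ->
  forall (M : 'M[C]_k) (B : 'M[C]_(k, p)),
  \sum_r a (upd B r (row r (M *m B))) = \tr M * a B.
Proof.
move=> ml al M B; rewrite mulr_suml; apply: eq_bigr => r _.
rewrite row_mul (mulmx_sum_row (row r M)) upd_sum // (bigD1 r) //= big1 ?addr0.
  by rewrite updZ // upd_row mxE.
by move=> j jr; rewrite updZ // alternating_upd ?mulr0 // eq_sym.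
Qed.

Lemma act_multilinear (p k : nat) (X : 'M[C]_p) (a : form p k) :
  multilinear a -> multilinear (act X a).
Proof.
move=> ml; apply: multilinearP => A r b d u v; rewrite /act !mulr_sumr -big_split.
apply: eq_bigr => s _ /=; have [->|sr] := eqVneq s r.
  by rewrite !row_upd !upd_upd mulmxDl -!scalemxAl multilinear_upd.
rewrite !row_upd_neq // !(@updC _ _ _ _ r s) 1?eq_sym //.
by rewrite multilinear_upd.
Qed.

Lemma act_alternating (p k : nat) (X : 'M[C]_p) (a : form p k) :
  multilinear a -> alternating a -> alternating (act X a).
Proof.
move=> ml al A i j ij Aij; rewrite /act (bigD1 i) //= (bigD1 j) 1?eq_sym //=.
rewrite big1 ?addr0 => [|s /andP[si sj]]; last first.
  by apply: (al _ i j ij); rewrite !row_upd_neq // eq_sym.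
have := alternating_tperm ml al (upd A i (row i A *m X)) ij.
rewrite -Aij => /eqP; rewrite -addr_eq0 => /eqP <-; rewrite addrC; congr (a _ + _).
apply/matrixP=> p' q; rewrite !mxE.
have Aq : A i q = A j q by move/rowP: Aij => /(_ q); rewrite !mxE.
case: tpermP => [->|->|/eqP/negbTE pi /eqP/negbTE pj]; last by rewrite pi pj.
  by rewrite (negbTE ij) eq_sym (negbTE ij) Aq.
by rewrite !eqxx.
Qed.

Lemma act_top k (a : form k k) : multilinear a -> alternating a ->
  forall X A, act X a A = \tr X * a A.
Proof.
move=> ml al X A.
rewrite (top_formE (act_multilinear X ml) (act_alternating X ml al)) (top_formE ml al A).
rewrite mulrCA; congr (_ * _); rewrite -sum_upd_mul //; apply: eq_bigr => r _.
by rewrite mulmx1 -row_mul mul1mx.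
Qed.
End TopForms.

(** * Alternating sums and the exterior derivative of a parallel form *)

Section AlternatingSums.
Context {R : realType} {m : nat}.
Local Notation C := R[i].
Local Notation form := (Defs.form R m).
Local Notation multilinear := Defs.multilinear.
Local Notation alternating := Defs.alternating.

Lemma form_upd_row' k (a : form k.+1) : multilinear a -> alternating a ->
  forall A r v, a (upd A r v) = (-1) ^+ r * a (col_mx v (row' r A)).
Proof.
move=> ml al A r v.
have := alternating_perm ml al (col_mx v (row' r A)) (lift_perm r ord0 1).
rewrite odd_lift_perm odd_perm1 addbF addbF signr_odd => <-; congr a.
apply/matrixP=> i j; rewrite [in RHS]mxE [in LHS]mxE.
case: (unliftP r i) => [i'|] ->.
  rewrite lift_perm_lift perm1 eq_sym (negbTE (neq_lift _ _)).
  have -> : lift ord0 i' = rshift 1 i' by apply: val_inj.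
  by rewrite (@col_mxEd _ 1) mxE.
rewrite eqxx lift_perm_id.
have -> : ord0 = lshift k (ord0 : 'I_1) by apply: val_inj.
by rewrite (@col_mxEu _ 1).
Qed.

(** A pair [(r, s)] encodes the removal of row [r], then of row [s] among the remaining ones; its
    image removes the same two rows in the opposite order. *)
Definition lift_swap k (p : 'I_k.+2 * 'I_k.+1) : 'I_k.+2 * 'I_k.+1 :=
  (lift p.1 p.2, inord (unbump (lift p.1 p.2) p.1)).

Lemma lift_swapK k (p : 'I_k.+2 * 'I_k.+1) :
  [/\ (lift_swap p).2 = unbump (bump p.1 p.2) p.1 :> nat,
      lift (lift_swap p).1 (lift_swap p).2 = p.1 & lift_swap (lift_swap p) = p].
Proof.
case: p => r s; rewrite /lift_swap /=.
have h1 : (unbump (bump r s) r < k.+1)%N.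
  by have := ltn_ord r; have := ltn_ord s; rewrite /unbump /bump /=; lia.
have e1 : lift (lift r s) (inord (unbump (bump r s) r)) = r.
  apply: val_inj; rewrite /= inordK // /unbump /bump; lia.
split=> //; first by rewrite inordK.
rewrite e1; congr pair; apply: val_inj => /=.
by move: (congr1 val e1) => /= ->; rewrite bumpK inordK.
Qed.

Lemma lift_swap_sign k (p : 'I_k.+2 * 'I_k.+1) :
  (-1) ^+ (lift_swap p).1 * (-1) ^+ (lift_swap p).2 = - ((-1) ^+ p.1 * (-1) ^+ p.2) :> C.
Proof.
have [-> _ _] := lift_swapK p; rewrite -!exprD.
case: p => r s /=.
have -> : (bump r s + unbump (bump r s) r = if (s < r)%N then r + s - 1 else (r + s).+1)%N.
  by rewrite /unbump /bump; case: ifP; lia.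
case: ifP => h; last by rewrite exprS mulN1r.
by rewrite -[in RHS](@subnK 1 (r + s)) ?addn1 ?exprS ?mulN1r ?opprK //; lia.
Qed.

Lemma row'_lift_swap k (p : 'I_k.+2 * 'I_k.+1) (A : 'M[C]_(k.+2, m)) :
  row' (lift_swap p).2 (row' (lift_swap p).1 A) = row' p.2 (row' p.1 A).
Proof.
apply/matrixP=> i j; rewrite !mxE; congr (A _ _); apply: val_inj => /=.
have [-> _ _] := lift_swapK p; case: p => r s /=.
rewrite /unbump /bump; lia.
Qed.

(** Reindexing by the involution [lift_swap] exchanges the two distinguished rows, keeps the others
    and reverses the sign. *)
Lemma double_sum_swap k (phi : 'rV[C]_m -> 'rV[C]_m -> 'M[C]_(k, m) -> C) (A : 'M[C]_(k.+2, m)) :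
  \sum_(r < k.+2) (-1) ^+ r * \sum_(s < k.+1) (-1) ^+ s *
     phi (row r A) (row s (row' r A)) (row' s (row' r A)) =
  - \sum_(r < k.+2) (-1) ^+ r * \sum_(s < k.+1) (-1) ^+ s *
     phi (row s (row' r A)) (row r A) (row' s (row' r A)).
Proof.
have sw_inj : injective (@lift_swap k).
  by apply: (can_inj (g := @lift_swap k)) => p; case: (lift_swapK p).
under eq_bigr do rewrite mulr_sumr; under [in RHS]eq_bigr do rewrite mulr_sumr.
rewrite !pair_big /= (reindex_inj sw_inj) /=.
rewrite -sumrN; apply: eq_bigr => p _.
rewrite !mulrA lift_swap_sign row'_lift_swap mulNr; congr (- (_ * phi _ _ _)).
  by apply/rowP=> j; rewrite !mxE.
by have [_ e _] := lift_swapK p; apply/rowP=> j; rewrite !mxE e.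
Qed.

(* The part of the exterior derivative of a parallel form that comes from a   *)
(* connection form X.                                                          *)
Definition ext (X : 'I_m -> 'M[C]_m) k (a : form k) : form k.+1 :=
  fun A => \sum_(r < k.+1) (-1) ^+ r * act (comb X (row r A)) a (row' r A).

Lemma actD k (a : form k) : multilinear a ->
  forall X Y A, act (X + Y) a A = act X a A + act Y a A.
Proof.
move=> ml X Y A; rewrite /act -big_split; apply: eq_bigr => r _.
by rewrite mulmxDr updD.
Qed.

Lemma actZ k (a : form k) : multilinear a ->
  forall c X A, act (c *: X) a A = c * act X a A.
Proof.
move=> ml c X A; rewrite /act mulr_sumr; apply: eq_bigr => r _.
by rewrite -scalemxAr updZ.
Qed.

Lemma act_comb k (a : form k) : multilinear a ->
  forall X u A, act (comb X u) a A = \sum_j u 0 j * act (X j) a A.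
Proof.
move=> ml X u A; rewrite /comb.
apply: (big_ind2 (fun M c => act M a A = c)).
- by rewrite /act big1 // => r _; rewrite mulmx0 upd0.
- by move=> M c M' c' <- <-; rewrite actD.
- by move=> j _; rewrite actZ.
Qed.

Lemma extD k (a : form k) : multilinear a ->
  forall X Y A, ext (fun j => X j + Y j) a A = ext X a A + ext Y a A.
Proof.
move=> ml X Y A; rewrite /ext -big_split; apply: eq_bigr => r _.
by rewrite combD actD // mulrDr.
Qed.

(** [ext] antisymmetrizes over the differentiating vector and the vector acted on, so a connection
    symmetric in these two contributes nothing: the sum equals its own opposite. *)
Lemma ext_sym k (a : form k) : multilinear a -> alternating a ->
  forall X : 'I_m -> 'M[C]_m, (forall u v, v *m comb X u = u *m comb X v) ->
  forall A, ext X a A = 0.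
Proof.
case: k a => [|k] a ml al X sX A.
  by rewrite /ext big1 // => r _; rewrite /act big_ord0 mulr0.
have e B Y : act Y a B =
    \sum_(s < k.+1) (-1) ^+ s * a (col_mx (row s B *m Y) (row' s B)).
  by apply: eq_bigr => s _; rewrite form_upd_row'.
rewrite /ext; under eq_bigr do rewrite e.
set S := \sum_r _.
apply: eq_opp0.
rewrite {1}/S (double_sum_swap (fun u v B => a (col_mx (v *m comb X u) B))).
apply: (f_equal -%R); apply: eq_bigr => r _; apply: (f_equal ( *%R _)).
by apply: eq_bigr => s _; rewrite sX.
Qed.

End AlternatingSums.

(** * The derivation action on wedge products and bilinear forms *)

Section Wedge.
Context {R : realType} {m : nat}.
Local Notation C := R[i].
Local Notation form := (Defs.form R m).
Local Notation multilinear := Defs.multilinear.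
Local Notation alternating := Defs.alternating.

Lemma row_perm_upd k (s : 'S_k) (A : 'M[C]_(k, m)) r v :
  row_perm s (upd A (s r) v) = upd (row_perm s A) r v.
Proof. by apply/matrixP=> i j; rewrite !mxE (inj_eq perm_inj). Qed.

Lemma usubmx_upd_lshift p q (A : 'M[C]_(p + q, m)) r v :
  usubmx (upd A (lshift q r) v) = upd (usubmx A) r v.
Proof. by apply/matrixP=> i j; rewrite !mxE (inj_eq (@lshift_inj _ _)). Qed.

Lemma usubmx_upd_rshift p q (A : 'M[C]_(p + q, m)) r v :
  usubmx (upd A (rshift p r) v) = usubmx A.
Proof. by apply/matrixP=> i j; rewrite !mxE eq_lrshift. Qed.

Lemma dsubmx_upd_lshift p q (A : 'M[C]_(p + q, m)) r v :
  dsubmx (upd A (lshift q r) v) = dsubmx A.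
Proof. by apply/matrixP=> i j; rewrite !mxE eq_rlshift. Qed.

Lemma dsubmx_upd_rshift p q (A : 'M[C]_(p + q, m)) r v :
  dsubmx (upd A (rshift p r) v) = upd (dsubmx A) r v.
Proof. by apply/matrixP=> i j; rewrite !mxE (inj_eq (@rshift_inj _ _)). Qed.

Lemma wedge_multilinear p q (a : form p) (b : form q) :
  multilinear a -> multilinear b -> multilinear (wedge a b).
Proof.
move=> ma mb; apply: multilinearP => A r x y u v; rewrite /wedge.
rewrite !mulr_sumr -big_split; apply: eq_bigr => s _ /=.
rewrite -[r](permKV s) !row_perm_upd.
case: (split_ordP ((s^-1)%g r)) => i ->.
  rewrite !usubmx_upd_lshift !dsubmx_upd_lshift (multilinear_upd ma).
  by move: (a _) (a _) (b _) (_%:R)^-1 (_ ^+ _) => *; ring.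
rewrite !usubmx_upd_rshift !dsubmx_upd_rshift (multilinear_upd mb).
by move: (a _) (b _) (b _) (_%:R)^-1 (_ ^+ _) => *; ring.
Qed.

Lemma wedge_alternating p q (a : form p) (b : form q) : alternating (wedge a b).
Proof.
move=> A i j ij Aij; rewrite /wedge; set S := \sum_s _.
suff /eq_opp0 -> : S = - S by rewrite mulr0.
rewrite {1}/S (reindex_inj (mulIg (tperm i j))) /= -sumrN; apply: eq_bigr => s _.
rewrite odd_permM odd_tperm ij signr_addb expr1 mulrN1 mulNr.
suff -> : row_perm (s * tperm i j)%g A = row_perm s A by [].
apply/matrixP=> x y; rewrite !mxE permM.
have Ay : A i y = A j y by move/rowP: Aij => /(_ y); rewrite !mxE.
by case: tpermP => // ->.
Qed.

Lemma act_wedge p q (a : form p) (b : form q) Y A :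
  act Y (wedge a b) A = wedge (act Y a) b A + wedge a (act Y b) A.
Proof.
rewrite /act /wedge -mulr_sumr -mulrDr exchange_big -big_split /=; congr (_ * _).
apply: eq_bigr => s _.
(* After reindexing by [s] the modified row is named by its position in the permuted matrix, so the
   sum splits into the arguments of [a] and those of [b]. *)
rewrite -mulr_sumr -mulrDr (reindex_inj (@perm_inj _ s)) /=; congr (_ * _).
rewrite big_split_ord /=; congr (_ + _).
  rewrite mulr_suml; apply: eq_bigr => r _.
  rewrite row_perm_upd usubmx_upd_lshift dsubmx_upd_lshift.
  by congr (a (upd _ _ _) * _); apply/rowP=> j; rewrite !mxE; apply: eq_bigr => i _; rewrite !mxE.
rewrite mulr_sumr; apply: eq_bigr => r _.
rewrite row_perm_upd usubmx_upd_rshift dsubmx_upd_rshift.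
by congr (_ * b (upd _ _ _)); apply/rowP=> j; rewrite !mxE; apply: eq_bigr => i _; rewrite !mxE.
Qed.

Lemma wedge_pow_multilinear w k : multilinear w -> multilinear (@wedge_pow R m w k).
Proof.
move=> mw; elim: k => [|k IH]; first by case.
exact: (@wedge_multilinear 2 k.*2).
Qed.

Lemma wedge_pow_alternating w k : alternating (@wedge_pow R m w k).
Proof. by case: k => [|k]; [move=> A [] | exact: (@wedge_alternating 2 k.*2)]. Qed.

Lemma act_wedge_pow_eq0 w Y k : (forall A, act Y w A = 0) ->
  forall A, act Y (@wedge_pow R m w k) A = 0.
Proof.
move=> w0; elim: k => [|k IH] A; first by rewrite /act big_ord0.
rewrite -[LHS]/(act Y (wedge w (wedge_pow w k)) A) act_wedge /wedge.
rewrite !big1 ?mulr0 ?addr0 // => s _.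
  by rewrite IH mulr0 mulr0.
by rewrite w0 mul0r mulr0.
Qed.

Lemma bilinear_multilinear (W : 'M[C]_m) : multilinear (bilinear_form W).
Proof.
apply: multilinearP => A r b d u v; rewrite /bilinear_form.
have [->|/negbTE r0] := eqVneq r ord0.
  rewrite !row_upd !row_upd_neq // !mulmxDl -!scalemxAl !mxE; congr (_ + _).
have -> : r = ord_max by apply: val_inj; case: r r0 => [[|[|]]].
by rewrite !row_upd !row_upd_neq // linearD !linearZ /= mulmxDr -!scalemxAr !mxE.
Qed.

Lemma bilinear_alternating (W : 'M[C]_m) : W^T = - W -> alternating (bilinear_form W).
Proof.
move=> WT A i j ij Aij; rewrite /bilinear_form.
have -> : row ord_max A = row ord0 A.
  have ord2 (l : 'I_2) : l = ord0 \/ l = ord_max.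
    by case: l => [[|[|//]] h]; [left|right]; apply: val_inj.
  by move: ij Aij; case: (ord2 i) => ->; case: (ord2 j) => -> //; rewrite eqxx.
set v := row _ _; set M := v *m W *m v^T.
have : M^T = - M by rewrite /M !trmx_mul trmxK WT !mulNmx !mulmxN mulmxA.
by move/matrixP => /(_ 0 0); rewrite mxE [in RHS]mxE => /eq_opp0.
Qed.

Lemma bilinear_act (W Y : 'M[C]_m) A :
  act Y (bilinear_form W) A = bilinear_form (Y *m W + W *m Y^T) A.
Proof.
rewrite /act big_ord_recl big_ord1 /bilinear_form.
have -> : lift ord0 ord0 = ord_max :> 'I_2 by exact: val_inj.
rewrite !row_upd (@row_upd_neq _ _ _ _ ord0) // (@row_upd_neq _ _ _ _ ord_max) //.
by rewrite mulmxDr mulmxDl trmx_mul !mulmxA [RHS]mxE.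
Qed.

End Wedge.

(** * Exterior derivative of the power of a symplectic form *)

Section CoclosedPower.
Context {R : realType}.
Local Notation C := R[i].
Local Notation form := (Defs.form R).
Local Notation multilinear := Defs.multilinear.
Local Notation alternating := Defs.alternating.

(** The wedge with a 1-form, expanded along the row fed to it; this avoids the sum over permutations
    of [wedge]. *)
Definition one_wedge m k (al : 'cV[C]_m) (be : form m k) : form m k.+1 :=
  fun B => \sum_(r < k.+1) (-1) ^+ r * ((row r B *m al) 0 0 * be (row' r B)).

Lemma row'_upd_lift m k (A : 'M[C]_(k.+1, m)) (r : 'I_k.+1) (i : 'I_k) v :
  row' r (upd A (lift r i) v) = upd (row' r A) i v.
Proof. by apply/matrixP=> a b; rewrite !mxE (inj_eq lift_inj). Qed.

Lemma row_row' m k (A : 'M[C]_(k.+1, m)) (r : 'I_k.+1) (i : 'I_k) :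
  row i (row' r A) = row (lift r i) A.
Proof. by apply/rowP=> j; rewrite !mxE. Qed.

Lemma one_wedge_multilinear m k al (be : form m k) :
  multilinear be -> multilinear (one_wedge al be).
Proof.
move=> ml; apply: multilinearP => A r b d u v; rewrite /one_wedge.
rewrite !mulr_sumr -big_split; apply: eq_bigr => s _ /=.
case: (unliftP s r) => [i ->|->].
  rewrite !row'_upd_lift !row_upd_neq ?neq_lift // (multilinear_upd ml).
  by move: (be _) (be _) ((_ *m _) _ _) ((-1) ^+ _) => *; ring.
rewrite !row_upd !row'_upd mulmxDl -!scalemxAl !mxE.
by move: (be _) (\sum_j _) (\sum_j _) ((-1) ^+ _) => *; ring.
Qed.

(** Both sides evaluate [be] on the same rows in different orders: on the right row [i] takes the
    place of the omitted row [lift i s]. The sign is that of [lift_swap]. *)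
Lemma form_row'_lift m k (be : form m k.+1) : multilinear be -> alternating be ->
  forall (B : 'M[C]_(k.+2, m)) (i : 'I_k.+2) (s : 'I_k.+1),
  (-1) ^+ (lift i s) * be (row' (lift i s) B) =
  - ((-1) ^+ i * be (upd (row' i B) s (row i B))).
Proof.
move=> ml al B i s; have [_ e _] := lift_swapK (i, s).
have sg := @lift_swap_sign R _ (i, s); have rr := row'_lift_swap (i, s) B.
move: e sg rr; set j := (lift_swap (i, s)).2; rewrite /= => e sg rr.
rewrite -[in LHS](upd_row (row' (lift i s) B) j) row_row' e.
by rewrite !form_upd_row' // rr !mulrA sg mulNr.
Qed.

Lemma one_wedge_alternating m k al (be : form m k.+1) :
  multilinear be -> alternating be -> alternating (one_wedge al be).
Proof.
move=> ml alt B i j ij Bij; rewrite /one_wedge.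
rewrite (bigD1 i) //= (bigD1 j) 1?eq_sym //= big1 ?addr0 => [|r /andP[ri rj]].
  case: (unliftP i j) ij Bij => [s -> ij Bij|->]; last by rewrite eqxx.
  have e : upd (row' i B) s (row i B) = row' i B by rewrite Bij -row_row' upd_row.
  by rewrite [_ ^+ lift i s * _]mulrCA form_row'_lift // e -Bij mulrCA mulrN subrr.
case: (unliftP r i) ri ij Bij => [i' -> _|->]; last by rewrite eqxx.
case: (unliftP r j) rj => [j' -> _|->]; last by rewrite eqxx.
by rewrite (inj_eq lift_inj) -!row_row' => ij Bij; rewrite (alt _ i' j') ?mulr0.
Qed.

Lemma act_one_wedge m k al (be : form m k) Z B :
  act Z (one_wedge al be) B = one_wedge al (act Z be) B + one_wedge (Z *m al) be B.
Proof.
rewrite /act /one_wedge exchange_big -big_split; apply: eq_bigr => r _ /=.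
rewrite -mulr_sumr -mulrDr; congr (_ * _).
rewrite (bigD1_ord r) //= row_upd row'_upd addrC; congr (_ + _); last by rewrite mulmxA.
rewrite mulr_sumr; apply: eq_bigr => s _.
by rewrite row_upd_neq ?neq_lift // row'_upd_lift row_row'.
Qed.

Lemma col_mx_entry0 m k (v : 'rV[C]_m) (B : 'M[C]_(k, m)) j :
  (col_mx v B : 'M[C]_(k.+1, m)) ord0 j = v 0 j.
Proof. by rewrite (_ : ord0 = lshift k (0 : 'I_1)) ?(@col_mxEu _ 1) //; apply: val_inj. Qed.

Lemma col_mx_entryS m k (v : 'rV[C]_m) (B : 'M[C]_(k, m)) i j :
  (col_mx v B : 'M[C]_(k.+1, m)) (lift ord0 i) j = B i j.
Proof. by rewrite (_ : lift ord0 i = rshift 1 i) ?(@col_mxEd _ 1) //; apply: val_inj. Qed.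

Lemma row0_col_mx m k (v : 'rV[C]_m) (B : 'M[C]_(k, m)) :
  row ord0 (col_mx v B : 'M[C]_(k.+1, m)) = v.
Proof. by apply/rowP=> j; rewrite mxE col_mx_entry0. Qed.

Lemma row'0_col_mx m k (v : 'rV[C]_m) (B : 'M[C]_(k, m)) :
  row' ord0 (col_mx v B : 'M[C]_(k.+1, m)) = B.
Proof. by apply/matrixP=> i j; rewrite mxE col_mx_entryS. Qed.

Lemma upd0_col_mx m k (v w : 'rV[C]_m) (B : 'M[C]_(k, m)) :
  upd (col_mx v B : 'M[C]_(k.+1, m)) ord0 w = col_mx w B.
Proof.
apply/matrixP=> i j; rewrite [LHS]mxE; case: (unliftP ord0 i) => [l|] ->.
  by rewrite !col_mx_entryS.
by rewrite !col_mx_entry0.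
Qed.

Lemma updS_col_mx m k (v w : 'rV[C]_m) (B : 'M[C]_(k, m)) r :
  upd (col_mx v B : 'M[C]_(k.+1, m)) (lift ord0 r) w = col_mx v (upd B r w).
Proof.
apply/matrixP=> i j; rewrite [LHS]mxE; case: (unliftP ord0 i) => [l|] ->.
  by rewrite !col_mx_entryS mxE (inj_eq lift_inj).
by rewrite !col_mx_entry0.
Qed.

Section Contraction.
Context {k : nat}.
Local Notation m := k.+3.
Variables (W : 'M[C]_m) (be : form m k.+1).
Hypotheses (WT : W^T = - W) (ml : multilinear be) (al : alternating be).
Hypothesis be_inv : forall Y, Y *m W + W *m Y^T = 0 -> forall A, act Y be A = 0.

Let flat (v : 'rV[C]_m) : 'cV[C]_m := (v *m W)^T.
(** The map [(v, B) |-> (flat v ^ be)(B)], a priori alternating in [B] only. Once it is alternating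
    in all arguments it is a multiple of the determinant, and wedging [be] with [flat v] is
    contracting this top form with [v]. *)
Let top : form m m := fun A => one_wedge (flat (row 0 A)) be (row' 0 A).

Let flat_self v : v *m flat v = 0.
Proof.
have : (v *m flat v)^T = - (v *m flat v).
  by rewrite /flat !trmx_mul !trmxK WT mulNmx mulmxN opprK mulmxA.
move: (v *m _) => M /matrixP /(_ 0 0); rewrite !mxE => /eq_opp0 M0.
by apply/matrixP=> i j; rewrite !ord1 M0 mxE.
Qed.

Let top_multilinear : multilinear top.
Proof.
apply: multilinearP => A r b d u v; rewrite /top.
case: (unliftP 0 r) => [i ->|->].
  rewrite !row'_upd_lift !row_upd_neq ?neq_lift //.
  exact: (multilinear_upd (one_wedge_multilinear _ ml)).
rewrite !row_upd !row'_upd /one_wedge !mulr_sumr -big_split; apply: eq_bigr => s _ /=.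
rewrite /flat mulmxDl -!scalemxAl linearD !linearZ /= mulmxDr -!scalemxAr !mxE.
by move: (be _) ((-1) ^+ _) (\sum_j _) (\sum_j _) => *; ring.
Qed.

(* The transvection u |-> w(v, u) v is infinitesimally symplectic, which kills *)
(* the contraction as soon as v is repeated.                                   *)
Let top_alternating0 A (j : 'I_k.+2) : row 0 A = row (lift 0 j) A -> top A = 0.
Proof.
move=> A0; rewrite /top; set v := row 0 A; set B := row' 0 A.
have Bj : row j B = v by rewrite row_row' -A0.
rewrite /one_wedge (bigD1_ord j) //= Bj flat_self mxE mul0r mulr0 add0r.
pose Y := flat v *m v.
have Y0 : Y *m W + W *m Y^T = 0.
  have fl : flat v = - (W *m v^T) by rewrite /flat trmx_mul WT mulNmx.
  by rewrite /Y trmx_mul {2}/flat trmxK fl !mulNmx -!mulmxA addNr.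
have := be_inv Y0 (row' j B); rewrite /act => h.
rewrite (eq_bigr (fun s : 'I_k.+1 => - (-1) ^+ j * be (upd (row' j B) s (row s (row' j B) *m Y)))).
  by rewrite -mulr_sumr h mulr0.
move=> s _; rewrite mulrCA form_row'_lift // Bj.
rewrite /Y mulmxA [row s (row' j B) *m flat v]mx11_scalar mul_scalar_mx updZ // row_row'.
by move: (be _) ((_ *m _) _ _) ((-1) ^+ _) => *; ring.
Qed.

Let top_alternating : alternating top.
Proof.
move=> A i j; case: (unliftP 0 i) => [i' ->|->]; case: (unliftP 0 j) => [j' ->|->].
- rewrite (inj_eq lift_inj) -!row_row' => ij h.
  exact: (one_wedge_alternating _ ml al ij h).
- by move=> _ /esym; apply: top_alternating0.
- by move=> _; apply: top_alternating0.
- by rewrite eqxx.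
Qed.

Let top_col (v : 'rV[C]_m) (B : 'M[C]_(k.+2, m)) : top (col_mx v B) = one_wedge (flat v) be B.
Proof.
by rewrite /top row0_col_mx row'0_col_mx.
Qed.

(** [Z] acts on [top] by its trace, here zero. This action is the sum of a term on [v], one on [be]
    and one on [flat v]; self-adjointness of [Z] for [W] makes the first and the last equal. *)
Let one_wedge_act Z (v : 'rV[C]_m) (B : 'M[C]_(k.+2, m)) : W *m Z^T = Z *m W -> \tr Z = 0 ->
  one_wedge (flat v) (act Z be) B = - (2%:R * top (col_mx (v *m Z) B)).
Proof.
move=> WZ trZ; have := act_top top_multilinear top_alternating Z (col_mx v B).
rewrite {1}/act (bigD1_ord ord0) //= row0_col_mx upd0_col_mx.
under eq_bigr do rewrite -row_row' row'0_col_mx updS_col_mx top_col.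
rewrite -/(act Z (one_wedge (flat v) be) B).
rewrite trZ mul0r act_one_wedge (_ : Z *m flat v = flat (v *m Z)) -?top_col.
  by move: (one_wedge _ _ _) (top _) => x y h; rewrite -[LHS]subr0 -h; ring.
by rewrite /flat -mulmxA -WZ !trmx_mul trmxK mulmxA.
Qed.

Variable X : 'I_m -> 'M[C]_m.
Hypothesis WX : forall j, W *m (X j)^T = X j *m W.
Hypothesis trX : forall j, \tr (X j) = 0.
Hypothesis tr_flip : forall v, \tr (comb (flip X) v) = 0.
Hypothesis Wunit : W \in unitmx.

Let comb_adj u : W *m (comb X u)^T = comb X u *m W.
Proof.
rewrite /comb linear_sum /= mulmx_sumr mulmx_suml; apply: eq_bigr => j _.
by rewrite linearZ /= -scalemxAr WX scalemxAl.
Qed.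

Let comb_tr u : \tr (comb X u) = 0.
Proof. by rewrite /comb linear_sum /= big1 // => j _; rewrite linearZ /= trX mulr0. Qed.

(** Exchanging the row paired with [flat v] and the row that differentiates turns each inner sum
    into an instance of [one_wedge_act]. As [v *m comb X u = u *m comb (flip X) v], the total is a
    multiple of the action of [comb (flip X) v] on [top], hence of its trace. *)
Let one_wedge_ext v A : one_wedge (flat v) (ext X be) A = 0.
Proof.
rewrite /one_wedge /ext.
under eq_bigr => r _.
  rewrite mulr_sumr.
  under eq_bigr do rewrite mulrCA.
  over.
rewrite (double_sum_swap (fun u u' B => (u *m flat v) 0 0 * act (comb X u') be B)).
rewrite (eq_bigr (fun r => - (2%:R * top (upd A r (row r A *m comb (flip X) v))))).
  rewrite sumrN opprK -mulr_sumr.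
  rewrite -[X in _ * X]/(act (comb (flip X) v) top A).
  by rewrite act_top // tr_flip mul0r mulr0.
move=> r _; rewrite -/(one_wedge _ _ _) (one_wedge_act _ _ (comb_adj _) (comb_tr _)).
rewrite (form_upd_row' top_multilinear top_alternating) mul_comb_flip.
by rewrite mulrN mulrCA.
Qed.

(** [A] has one row less than the dimension, so some [v != 0] is [W]-orthogonal to all its rows.
    Wedge with [flat v] and evaluate on [A] preceded by a basis vector not orthogonal to [v]: only a
    nonzero multiple of [ext X be A] remains. *)
Lemma ext_coclosed A : ext X be A = 0.
Proof.
have [v v0 vA] : exists2 v : 'rV[C]_m, v != 0 & v *m (W *m A^T) = 0.
  have : kermx (W *m A^T) != 0.
    rewrite kermx_eq0 /row_free; apply/eqP => h.
    by have := rank_leq_col (W *m A^T); rewrite h ltnn.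
  case/rowV0Pn => v /sub_kermxP vA v0; exists v => //.
have [j vj] : exists j, (v *m W) 0 j != 0.
  apply/existsP; apply: contraNT v0; rewrite negb_exists => /forallP h.
  have vW : v *m W = 0 by apply/rowP=> j; rewrite [RHS]mxE; apply/eqP; move: (h j); rewrite negbK.
  by rewrite -(mulmxK Wunit v) vW mul0mx.
have := one_wedge_ext v (col_mx (delta_mx 0 j : 'rV[C]_m) A).
rewrite /one_wedge (bigD1_ord ord0) //= big1 ?addr0 => [|r _]; last first.
  rewrite -row_row' row'0_col_mx (_ : row r A *m flat v = 0) ?mxE ?mul0r ?mulr0 //.
  have -> : row r A *m flat v = (v *m W *m (row r A)^T)^T.
    by rewrite /flat [RHS]trmx_mul trmxK.
  by rewrite -mulmxA tr_row colE [W *m _]mulmxA mulmxA vA mul0mx linear0.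
rewrite row0_col_mx row'0_col_mx mul1r => /eqP; rewrite mulf_eq0 => /orP[|/eqP//].
by rewrite /flat -rowE mxE [_^T _ _]mxE (negbTE vj).
Qed.
End Contraction.
End CoclosedPower.

Ltac mx_linear :=
  repeat match goal with |- context[@mulmx ?R ?a ?b ?c ?A ?B] =>
    move: (@mulmx R a b c A B) => ? end;
  apply/matrixP => ? ?; rewrite !mxE; field; rewrite ?pnatr_eq0.

(** * The Obata connection *)

Section QuaternionicConnection.
Context {F : realFieldType} {m : nat}.
Variables (I J : 'M[F]_m) (dI dJ : 'I_m -> 'M[F]_m).
Hypotheses (II : I *m I = - 1%:M) (JJ : J *m J = - 1%:M) (JI : J *m I = - (I *m J)).
Hypotheses (dII : forall j, dI j *m I = - (I *m dI j))
  (dJJ : forall j, dJ j *m J = - (J *m dJ j))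
  (dJI : forall j, dJ j *m I = - (dI j *m J) - I *m dJ j - J *m dI j).

Let IIl (A : 'M[F]_m) : I *m (I *m A) = - A.
Proof. by rewrite mulmxA II mulNmx mul1mx. Qed.
Let JJl (A : 'M[F]_m) : J *m (J *m A) = - A.
Proof. by rewrite mulmxA JJ mulNmx mul1mx. Qed.
Let JIl (A : 'M[F]_m) : J *m (I *m A) = - (I *m (J *m A)).
Proof. by rewrite mulmxA JI mulNmx mulmxA. Qed.
Let dIIl j (A : 'M[F]_m) : dI j *m (I *m A) = - (I *m (dI j *m A)).
Proof. by rewrite mulmxA dII mulNmx mulmxA. Qed.
Let dJJl j (A : 'M[F]_m) : dJ j *m (J *m A) = - (J *m (dJ j *m A)).
Proof. by rewrite mulmxA dJJ mulNmx mulmxA. Qed.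
Let dJIl j (A : 'M[F]_m) : dJ j *m (I *m A) =
  - (dI j *m (J *m A)) - I *m (dJ j *m A) - J *m (dI j *m A).
Proof. by rewrite mulmxA dJI !mulmxBl mulNmx !mulmxA. Qed.

Ltac mx_normalize :=
  repeat progress rewrite ?mulmxDl ?mulmxDr ?mulNmx ?mulmxN ?mulmx1 ?mul1mx
    -?scalemxAl -?scalemxAr -?mulmxA
    ?II ?JJ ?JI ?IIl ?JJl ?JIl ?dII ?dIIl ?dJJ ?dJJl ?dJI ?dJIl.

(* -(I' I + J' J + K' K) / 4 with K = J I: when E' = [Y0, E], this is Y0 minus *)
(* the average of its conjugates by 1, I, J, K.                                *)
Let Y j : 'M[F]_m := - 4%:R^-1 *: (dI j *m I + 2%:R *: (dJ j *m J) + J *m dI j *m J *m I).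

Let Y_I j : Y j *m I - I *m Y j = dI j.
Proof. by rewrite /Y; mx_normalize; mx_linear. Qed.

Let Y_J j : Y j *m J - J *m Y j = dJ j.
Proof. by rewrite /Y; mx_normalize; mx_linear. Qed.

Lemma exists_quaternionic_connection : exists Y : 'I_m -> 'M[F]_m, forall j,
  dI j = Y j *m I - I *m Y j /\ dJ j = Y j *m J - J *m Y j.
Proof. by exists Y => j; rewrite Y_I Y_J. Qed.

End QuaternionicConnection.

Definition torsion {F : fieldType} {m} (Y : 'I_m -> 'M[F]_m) : 'I_m -> 'M[F]_m :=
  fun j => Y j - flip Y j.

(** The Nijenhuis tensor as an algebraic function of the value [E] and the partial derivatives [dE]
    at one point. *)
Definition nijenhuis_of {F : fieldType} {m} (E : 'M[F]_m) (dE : 'I_m -> 'M[F]_m)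
    (u v : 'rV[F]_m) : 'rV[F]_m :=
  v *m comb dE (u *m E) - u *m comb dE (v *m E) + u *m comb dE v *m E - v *m comb dE u *m E.

Section ObataConnection.
Context {F : realFieldType} {m : nat}.
Variables (I J : 'M[F]_m) (dI dJ Y : 'I_m -> 'M[F]_m).
Hypotheses (II : I *m I = - 1%:M) (JJ : J *m J = - 1%:M) (JI : J *m I = - (I *m J)).
Hypotheses (dIE : forall j, dI j = Y j *m I - I *m Y j)
  (dJE : forall j, dJ j = Y j *m J - J *m Y j).

Let IIl (A : 'M[F]_m) : I *m (I *m A) = - A.
Proof. by rewrite mulmxA II mulNmx mul1mx. Qed.
Let JJl (A : 'M[F]_m) : J *m (J *m A) = - A.
Proof. by rewrite mulmxA JJ mulNmx mul1mx. Qed.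
Let JIl (A : 'M[F]_m) : J *m (I *m A) = - (I *m (J *m A)).
Proof. by rewrite mulmxA JI mulNmx mulmxA. Qed.

Ltac mx_normalize :=
  repeat progress rewrite ?mulmxDl ?mulmxDr ?mulNmx ?mulmxN ?mulmx1 ?mul1mx
    -?scalemxAl -?scalemxAr -?mulmxA ?II ?JJ ?JI ?IIl ?JJl ?JIl.

Local Notation T := (torsion Y).
Let t (u v : 'rV[F]_m) : 'rV[F]_m := v *m comb T u.

Let tE u v : t u v = v *m comb Y u - u *m comb Y v.
Proof. by rewrite /t combB mulmxBr mul_comb_flip. Qed.

Let t_anti u v : t v u = - t u v.
Proof. by rewrite !tE opprB. Qed.

Let tN u v : t (- u) v = - t u v.
Proof. by rewrite /t combN mulmxN. Qed.

Let tNr u v : t u (- v) = - t u v.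
Proof. by rewrite /t mulNmx. Qed.

(** For a connection preserving [E] the derivatives of [E] are commutators with [Y]; after
    cancellation only the antisymmetric part of [Y] is left. *)
Lemma nijenhuis_torsion (E : 'M[F]_m) (dE : 'I_m -> 'M[F]_m) u v :
  E *m E = - 1%:M -> (forall j, dE j = Y j *m E - E *m Y j) ->
  nijenhuis_of E dE u v = t u v - t (u *m E) (v *m E) + t (u *m E) v *m E + t u (v *m E) *m E.
Proof.
move=> EE dEY.
have dEw w : comb dE w = comb Y w *m E - E *m comb Y w.
  rewrite -comb_mull -comb_mulr -combB; apply: eq_bigr => j _.
  by rewrite dEY.
have EEl (A : 'M[F]_m) : E *m (E *m A) = - A by rewrite mulmxA EE mulNmx mul1mx.
rewrite /nijenhuis_of !dEw !tE !mulmxBl !mulmxBr !mulmxBl -!mulmxA EE.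
by rewrite ?EEl ?mulmxN ?mulmx1; mx_linear.
Qed.

Hypothesis nij_I : forall u v, nijenhuis_of I dI u v = 0.
Hypothesis nij_J : forall u v, nijenhuis_of J dJ u v = 0.
Hypothesis nij_K : forall u v,
  nijenhuis_of (J *m I) (fun j => dJ j *m I + J *m dI j) u v = 0.

(* Obtained by rewriting Obata's formula                                       *)
(* 2 D_u v = [u, v] + I [Iu, v] - J [u, Jv] + K [Iu, Jv]                       *)
(* in terms of a connection preserving I, J, K and of its torsion T.           *)
Definition obata_correction : 'I_m -> 'M[F]_m := fun j =>
  - 2%:R^-1 *: (T j + precomp I T j *m I - J *m T j *m J + J *m precomp I T j *m J *m I).
Local Notation Z := obata_correction.

Let Z_J j : Z j *m J = J *m Z j.
Proof.
rewrite /Z; move: (T j) (precomp I T j) => A B.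
by mx_normalize; mx_linear.
Qed.

Let combZE u : comb Z u = - 2%:R^-1 *: (comb T u + comb T (u *m I) *m I - J *m comb T u *m J
  + J *m comb T (u *m I) *m J *m I).
Proof.
by rewrite combZ combD combB combD !comb_mulr !comb_mull !comb_precomp.
Qed.

Let mulZE u v : v *m comb Z u = - 2%:R^-1 *: (t u v + t (u *m I) v *m I - t u (v *m J) *m J
  + t (u *m I) (v *m J) *m J *m I).
Proof.
by rewrite combZE -scalemxAr !(mulmxDr, mulmxBr) /t mulmxN !mulmxA.
Qed.

(** This says that [Y + Z] has no torsion. It is a linear consequence of the three Nijenhuis
    identities, that of [K] being taken at [(u *m J, v *m J)] so as to involve the same torsion
    values. *)
Let Z_sym u v : v *m comb Z u - u *m comb Z v = - t u v.
Proof.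
have KK : (J *m I) *m (J *m I) = - 1%:M by mx_normalize; mx_linear.
have nI := nijenhuis_torsion u v II dIE.
have nJ := nijenhuis_torsion u v JJ dJE.
have nK := @nijenhuis_torsion (J *m I) (fun j => dJ j *m I + J *m dI j) (u *m J) (v *m J) KK.
rewrite nij_I in nI; rewrite nij_J in nJ.
have {}nK : 0 = t (u *m J) (v *m J) - t (u *m I) (v *m I) - t (u *m I) (v *m J) *m J *m I
    - t (u *m J) (v *m I) *m J *m I.
  have JJI (w : 'rV[F]_m) : w *m J *m (J *m I) = - (w *m I).
    by rewrite -mulmxA [J *m _]mulmxA JJ mulNmx mul1mx mulmxN.
  rewrite -[LHS](nij_K (u *m J) (v *m J)) nK => [|j].
    by rewrite !JJI !tN !tNr !mulNmx opprK -!mulmxA.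
  by rewrite dIE dJE; mx_normalize; mx_linear.
rewrite !mulZE (t_anti u v) (t_anti (u *m J) (v *m I)) (t_anti u (v *m I)) (t_anti (u *m J) v).
rewrite !mulNmx; move: nI nJ nK.
move: (t (u *m I) v *m I) (t u (v *m J) *m J) (t (u *m I) (v *m J) *m J *m I) => a b c.
move: (t u (v *m I) *m I) (t (u *m J) v *m J) (t (u *m J) (v *m I) *m J *m I) => d e f.
move: (t u v) (t (u *m I) (v *m I)) (t (u *m J) (v *m J)) => p q r nI nJ nK.
apply/rowP=> k; move/rowP: nI => /(_ k); move/rowP: nJ => /(_ k); move/rowP: nK => /(_ k).
by rewrite !mxE => *; lra.
Qed.

(** Unlike for [J], the formula does not give this directly. It shows that [Z] is [I]-linear in the
    differentiating vector up to torsion terms, and [Z_sym] exchanges the two vectors; the torsion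
    terms then cancel. *)
Let Z_I j : Z j *m I = I *m Z j.
Proof.
suff h (u v : 'rV[F]_m) : v *m (I *m comb Z u) = v *m (comb Z u *m I).
  apply/row_matrixP=> i; have := h (delta_mx 0 j) (delta_mx 0 i).
  by rewrite comb_delta -!rowE => ->.
have swap (w : 'rV[F]_m) : w *m comb Z u = u *m comb Z w - t u w by rewrite -Z_sym addrC subrK.
rewrite mulmxA swap [RHS]mulmxA swap mulmxBl.
have -> : u *m comb Z (v *m I) = u *m comb Z v *m I + t v u *m I - t (v *m I) u.
  rewrite /t -!mulmxA -mulmxDr -mulmxBr; congr (_ *m _).
  rewrite !combZE -[v *m I *m I]mulmxA II mulmxN mulmx1 combN.
  by move: (comb T v) (comb T (v *m I)) => A B; mx_normalize; mx_linear.
rewrite (t_anti u v) (t_anti u (v *m I)) mulNmx.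
by move: (t u v *m I) (t u (v *m I)) (u *m comb Z v *m I) => a b c;
  apply/rowP=> k; rewrite !mxE; ring.
Qed.

Lemma obata_connection : exists G : 'I_m -> 'M[F]_m,
  (forall u v, v *m comb G u = u *m comb G v) /\
  forall j, dI j = G j *m I - I *m G j /\ dJ j = G j *m J - J *m G j.
Proof.
exists (fun j => Y j + Z j); split=> [u v|j].
  apply/eqP; rewrite -subr_eq0 !combD !mulmxDr opprD addrACA Z_sym -tE.
  by rewrite subrr.
by split; rewrite mulmxDl mulmxDr ?Z_I ?Z_J opprD addrACA subrr addr0.
Qed.

End ObataConnection.

(** * Correcting the Obata connection to preserve the metric *)

Section HyperhermitianConnection.
Context {F : realFieldType} {m : nat}.
Variables (I J g : 'M[F]_m) (dI dJ dg G : 'I_m -> 'M[F]_m).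
Hypotheses (gT : g^T = g) (gunit : g \in unitmx) (dgT : forall j, (dg j)^T = dg j).

(** Half the covariant derivative of [g] with one index raised. As [X j *m g] is symmetric, each of
    the two terms by which [X] acts on [g] restores one half of that derivative. *)
Let X j : 'M[F]_m := 2%:R^-1 *: ((dg j - G j *m g - g *m (G j)^T) *m invmx g).

Let Xg j : X j *m g = 2%:R^-1 *: (dg j - G j *m g - g *m (G j)^T).
Proof. by rewrite /X -scalemxAl mulmxKV. Qed.

Let Xg_sym j : X j *m g = g *m (X j)^T.
Proof.
rewrite -{2}gT -trmx_mul Xg linearZ /= !linearB /= !trmx_mul trmxK gT dgT.
exact: addrAC.
Qed.

Let dgE j : dg j = (G j + X j) *m g + g *m (G j + X j)^T.
Proof.
rewrite linearD /= mulmxDl mulmxDr -Xg_sym Xg.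
by move: (G j *m g) (g *m (G j)^T) (dg j) => a b c; apply/matrixP=> ? ?; rewrite !mxE; lra.
Qed.

(** Since [E] is parallel for [G], the covariant derivative [S] of [g] is Hermitian like [g]. Both
    satisfy [E *m S = - (S *m E^T)], so the quotient of [S] by [g] commutes with [E]. *)
Let X_comm (E : 'M[F]_m) (dE : 'I_m -> 'M[F]_m) j :
  E *m E = - 1%:M -> E *m g *m E^T = g ->
  dE j *m g *m E^T + E *m dg j *m E^T + E *m g *m (dE j)^T = dg j ->
  dE j = G j *m E - E *m G j -> X j *m E = E *m X j.
Proof.
move=> EE Eg dEg dEj; pose S := dg j - G j *m g - g *m (G j)^T.
have ET : E^T *m E^T = - 1%:M by rewrite -trmx_mul EE linearN /= trmx1.
have ES : E *m S *m E^T = S.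
  rewrite /S !mulmxBr !mulmxBl; move: dEg; rewrite dEj !linearB /= !trmx_mul.
  rewrite ?mulmxBl ?mulmxBr.
  have -> : G j *m E *m g *m E^T = G j *m g by rewrite -!mulmxA [E *m _]mulmxA Eg.
  have -> : E *m g *m (E^T *m (G j)^T) = g *m (G j)^T by rewrite mulmxA Eg.
  rewrite !mulmxA; move: (E *m G j *m g *m E^T) (E *m g *m (G j)^T *m E^T).
  move: (E *m dg j *m E^T) (G j *m g) (g *m (G j)^T) (dg j) => a b c d e f h.
  apply/matrixP=> x y; move/matrixP: h => /(_ x y).
  by rewrite !mxE => h; lra.
have skew A : E *m A *m E^T = A -> E *m A = - (A *m E^T).
  by move=> h; rewrite -[in RHS]h -mulmxA ET mulmxN mulmx1 opprK.
have gE : E^T *m invmx g = - (invmx g *m E).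
  rewrite -[LHS](mulKmx gunit) [g *m _]mulmxA -[g *m E^T]opprK -(skew _ Eg) mulNmx mulmxN.
  by rewrite mulmxK.
rewrite /X -/S -scalemxAl -scalemxAr mulmxA (skew _ ES) mulNmx -[in RHS]mulmxA gE.
by rewrite mulmxN opprK mulmxA.
Qed.

Hypotheses (II : I *m I = - 1%:M) (JJ : J *m J = - 1%:M).
Hypotheses (gI : I *m g *m I^T = g) (gJ : J *m g *m J^T = g).
Hypotheses
  (dgI : forall j, dI j *m g *m I^T + I *m dg j *m I^T + I *m g *m (dI j)^T = dg j)
  (dgJ : forall j, dJ j *m g *m J^T + J *m dg j *m J^T + J *m g *m (dJ j)^T = dg j).
Hypotheses (dIG : forall j, dI j = G j *m I - I *m G j)
  (dJG : forall j, dJ j = G j *m J - J *m G j).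

Lemma hyperhermitian_connection : exists X : 'I_m -> 'M[F]_m, forall j,
  [/\ X j *m I = I *m X j, X j *m J = J *m X j, X j *m g = g *m (X j)^T &
   [/\ dI j = (G j + X j) *m I - I *m (G j + X j),
       dJ j = (G j + X j) *m J - J *m (G j + X j)
     & dg j = (G j + X j) *m g + g *m (G j + X j)^T]].
Proof.
exists X => j.
have XI := X_comm II gI (dgI j) (dIG j); have XJ := X_comm JJ gJ (dgJ j) (dJG j).
split=> //; split; rewrite ?dgE //.
  by rewrite mulmxDl mulmxDr XI opprD addrACA subrr addr0.
by rewrite mulmxDl mulmxDr XJ opprD addrACA subrr addr0.
Qed.

End HyperhermitianConnection.

(** * Forms of type (q, 0) *)

Section TypeProjections.
Context {R : realType} {m : nat}.
Local Notation C := R[i].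
Local Notation form := (Defs.form R m).
Local Notation multilinear := Defs.multilinear.
Local Notation alternating := Defs.alternating.

Definition p10 (I : 'M[C]_m) : 'M[C]_m := 2^-1 *: (1%:M - 'i%C *: I).
Definition p01 (I : 'M[C]_m) : 'M[C]_m := 2^-1 *: (1%:M + 'i%C *: I).

Lemma proj10E (E : 'M[R]_m) v : proj10 E v = v *m p10 (cmx E).
Proof. by rewrite /proj10 /p10 -scalemxAr mulmxBr mulmx1 -scalemxAr. Qed.

Lemma proj01E (E : 'M[R]_m) v : proj01 E v = v *m p01 (cmx E).
Proof. by rewrite /proj01 /p01 -scalemxAr mulmxDr mulmx1 -scalemxAr. Qed.

Lemma imul_ii : 'i%C * 'i%C = -1 :> C.
Proof. by rewrite -expr2 sqr_i. Qed.

Lemma half_half : 2^-1 + 2^-1 = 1 :> C.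
Proof. by rewrite [RHS]splitr div1r. Qed.

Section Projections.
Variables (I : 'M[C]_m).
Hypothesis II : I *m I = - 1%:M.

Lemma p10_add_p01 : p10 I + p01 I = 1%:M.
Proof. by rewrite -scalerDr addrACA addNr addr0 scalerDr -scalerDl half_half scale1r. Qed.

Let iI_sq : ('i%C *: I) *m ('i%C *: I) = 1%:M.
Proof. by rewrite -scalemxAl -scalemxAr scalerA imul_ii II scaleN1r opprK. Qed.

Lemma p10_mul_p01 : p10 I *m p01 I = 0.
Proof.
rewrite /p10 /p01 -scalemxAl -scalemxAr mulmxBl mul1mx mulmxDr mulmx1 iI_sq.
by rewrite [_ + 1%:M]addrC subrr !scaler0.
Qed.

Lemma p01_mul_p10 : p01 I *m p10 I = 0.
Proof.
rewrite /p10 /p01 -scalemxAl -scalemxAr mulmxDl mul1mx mulmxBr mulmx1 iI_sq.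
by rewrite addrA subrK subrr !scaler0.
Qed.

Lemma p10_idem : p10 I *m p10 I = p10 I.
Proof.
by rewrite -[X in _ *m X = _](addrK (p01 I)) p10_add_p01 mulmxBr mulmx1 p10_mul_p01 subr0.
Qed.

Lemma p01_idem : p01 I *m p01 I = p01 I.
Proof.
rewrite -[X in _ *m X = _](addKr (p10 I)) p10_add_p01.
by rewrite mulmxDr mulmx1 mulmxN p01_mul_p10 oppr0 add0r.
Qed.

Lemma p10_comm X : X *m I = I *m X -> X *m p10 I = p10 I *m X.
Proof.
move=> h; rewrite /p10 -scalemxAr -scalemxAl mulmxBl mulmxBr mulmx1 mul1mx.
by rewrite -scalemxAr -scalemxAl h.
Qed.

Lemma mxtrace_mul_p10 X : \tr (X *m I) = 0 -> \tr (X *m p10 I) = 2^-1 * \tr X.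
Proof.
move=> h; rewrite /p10 -scalemxAr mulmxBr mulmx1 -scalemxAr.
by rewrite linearZ /= linearB /= linearZ /= h mulr0 subr0.
Qed.

Variable J : 'M[C]_m.
Hypotheses (JJ : J *m J = - 1%:M) (JI : J *m I = - (I *m J)).

Lemma p10_mulJ : p10 I *m J = J *m p01 I.
Proof.
rewrite /p10 /p01 -scalemxAl -scalemxAr mulmxBl mulmxDr mul1mx mulmx1.
by rewrite -scalemxAl -scalemxAr JI scalerN.
Qed.

(** Conjugation by [J] fixes [X] and negates [I], while the trace is invariant. *)
Lemma mxtrace_mulI X : X *m J = J *m X -> \tr (X *m I) = 0.
Proof.
move=> XJ; apply: eq_opp0.
have e1 : \tr (J *m (X *m I *m J)) = - \tr (X *m I).
  by rewrite mxtrace_mulC -(mulmxA _ J J) JJ mulmxN mulmx1 linearN.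
have e2 : J *m (X *m I *m J) = X *m I.
  rewrite !mulmxA -XJ -(mulmxA X J I) JI mulmxN mulNmx -!mulmxA JJ.
  by rewrite !mulmxN mulmx1 opprK.
by rewrite -{1}e2 e1.
Qed.

Lemma rank_p10 q : m = q.*2 -> \rank (p10 I) = q.
Proof.
move=> mq.
have Ju : J \in unitmx.
  have : J *m (- J) = 1%:M by rewrite mulmxN JJ opprK.
  by case/mulmx1_unit.
have e : \rank (p10 I) = \rank (p01 I).
  by rewrite -(mxrankMfree (p10 I) (B := J)) ?row_free_unit // p10_mulJ eqmxMfull // row_full_unit.
have h1 := mulmx0_rank_max p10_mul_p01.
have := mxrank_add (p10 I) (p01 I); rewrite p10_add_p01 mxrank1.
by move: h1; rewrite -e => h1 h2; move: mq h1 h2; move: (\rank _); lia.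
Qed.

(** A rank factorization: the rows of [E] are a basis of the (1,0) vectors and [F] gives the
    coordinates of the (1,0) part. The rank is [q] because [J] exchanges the two projections. *)
Lemma p10_factor q : m = q.*2 -> exists (E : 'M[C]_(q, m)) (F : 'M[C]_(m, q)),
  F *m E = p10 I /\ E *m F = 1%:M.
Proof.
move=> mq; have rq := rank_p10 mq.
rewrite -rq; move: (col_base_full (p10 I)) (row_base_free (p10 I)) (mulmx_base (p10 I)).
move: (col_base _) (row_base _) => F E Ff Ef FE.
exists E, F; split=> //; apply: (row_full_inj Ff); apply: (row_free_inj Ef).
by rewrite /= mulmx1 mulmxA -(mulmxA _ F) FE p10_idem.
Qed.
End Projections.

Section TypedForms.
Variables (I : 'M[R]_m).
Local Notation Ic := (cmx I).
Hypothesis II : Ic *m Ic = - 1%:M.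

Lemma act_row_eq0 k (a : form k) X A i : multilinear a -> row i A = 0 -> act X a A = 0.
Proof.
move=> ml Ai; rewrite /act big1 // => r _; have [e|ir] := eqVneq i r.
  by rewrite -e Ai mul0mx upd0.
by rewrite (@multilinear_row0 _ _ _ _ ml _ i) // row_upd_neq.
Qed.

Lemma ext_row_eq0 k (a : form k) X A i : multilinear a -> row i A = 0 -> ext X a A = 0.
Proof.
move=> ml Ai; rewrite /ext big1 // => r _; case: (unliftP r i) Ai => [j ->|->] Ai.
  by rewrite (@act_row_eq0 _ _ _ _ j) ?mulr0 // row_row'.
rewrite Ai /comb; under eq_bigr do rewrite mxE scale0r.
by rewrite big1 // /act; under eq_bigr do rewrite mulmx0 upd0 //; rewrite big1 ?mulr0.
Qed.

Lemma type_part_full k (a : form k) A : type_part I k a A = a (A *m p10 Ic).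
Proof.
rewrite /type_part (big_pred1 [set: 'I_k]%SET) => [|S].
  by congr a; apply/row_matrixP=> i; rewrite rowK inE proj10E row_mul.
rewrite /= eqEcard finset.subsetT cardsT card_ord /= eqn_leq.
by have := max_card (mem S); rewrite card_ord => ->.
Qed.

(** Any set of [k] indices other than the complement of [ord0] omits a later index, whose (1,0) row
    is then projected to zero. *)
Lemma type_part_pure k (f : form k.+1) (u : 'rV[C]_m) (E : 'M[C]_(k, m)) :
  (forall A i, row i A = 0 -> f A = 0) -> E *m p10 Ic = E ->
  type_part I k f (col_mx (u *m p01 Ic) E) = f (col_mx (u *m p01 Ic) E).
Proof.
move=> f0 Ep; rewrite /type_part (bigD1 [set~ ord0]%SET) /=; last first.
  by rewrite cardsC1 card_ord.
rewrite [X in _ + X]big1 ?addr0 => [|S /andP[/eqP cS S0]].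
  congr f; apply/row_matrixP=> i; rewrite rowK !inE.
  case: (unliftP ord0 i) => [j|] ->.
    rewrite eq_sym neq_lift proj10E -row_row' row'0_col_mx.
    by rewrite -[in RHS]Ep row_mul.
  by rewrite eqxx row0_col_mx proj01E -mulmxA p01_idem.
have [j jS] : exists j : 'I_k, lift ord0 j \notin S.
  apply/existsP; apply: contraR S0; rewrite negb_exists => /forallP h.
  rewrite eq_sym eqEcard cardsC1 card_ord cS leqnn andbT; apply/fintype.subsetP=> i.
  rewrite !inE; case: (unliftP ord0 i) => [j -> _|->]; rewrite ?eqxx //.
  by have := h j; rewrite negbK.
apply: (f0 _ (lift ord0 j)); rewrite rowK (negbTE jS) proj01E -row_row' row'0_col_mx.
by rewrite -Ep row_mul -mulmxA p10_mul_p01 // mulmx0.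
Qed.

Lemma type_q0_det q (a : form q) (E : 'M[C]_(q, m)) (F : 'M[C]_(m, q)) :
  multilinear a -> alternating a -> (forall A, a A = type_part I q a A) ->
  F *m E = p10 Ic -> forall A, a A = \det (A *m F) * a E.
Proof.
move=> ml al ty FE A.
by rewrite ty type_part_full -FE mulmxA det_mul_form.
Qed.

(** [X] preserves types, so [a] kills every summand that keeps the (0,1) vector among its arguments.
    In the remaining one this vector differentiates, and [X] acts on the basis [E] of the (1,0)
    vectors by its trace there. *)
Lemma trace_of_delbar_q0 q (a : form q) X (E : 'M[C]_(q, m)) (F : 'M[C]_(m, q)) (u : 'rV[C]_m) :
  multilinear a -> alternating a -> (forall A, a A = type_part I q a A) ->
  (forall j, X j *m Ic = Ic *m X j) ->
  F *m E = p10 Ic -> E *m F = 1%:M ->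
  type_part I q (ext X a) (col_mx (u *m p01 Ic) E) =
  \tr (comb X (u *m p01 Ic) *m p10 Ic) * a E.
Proof.
move=> ml al ty XI FE EF.
have Xp v : comb X v *m p10 Ic = p10 Ic *m comb X v.
  by apply: p10_comm; rewrite -comb_mulr -comb_mull; apply: eq_bigr => j _; rewrite XI.
have Ep : E *m p10 Ic = E by rewrite -FE mulmxA EF mul1mx.
rewrite type_part_pure //; last by move=> A i; apply: ext_row_eq0.
rewrite /ext (bigD1_ord ord0) //= big1 ?addr0 => [|r _]; last first.
  rewrite /act big1 ?mulr0 // => s _.
  case: q a E F ml al ty FE EF Ep r s => [|q] a E F ml al ty FE EF Ep r s; first by case: r.
  rewrite ty type_part_full (@multilinear_row0 _ _ _ _ ml _ ord0) //.
  rewrite row_mul; set B := row' _ _.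
  have B0 : row ord0 B *m p10 Ic = 0.
    rewrite /B row_row' (_ : lift _ _ = ord0); last exact: val_inj.
    by rewrite row0_col_mx -mulmxA p01_mul_p10 // mulmx0.
  have [->|s0] := eqVneq s ord0; last by rewrite row_upd_neq // eq_sym.
  by rewrite row_upd -mulmxA Xp mulmxA B0 mul0mx.
rewrite mul1r row0_col_mx row'0_col_mx; set Z := comb X _.
rewrite -[Z *m _]/(Z *m p10 Ic) -FE mulmxA mxtrace_mulC mulmxA -sum_upd_mul //.
apply: eq_bigr => r _; congr (a (upd _ _ _)).
by rewrite -row_mul -(mulmxA _ F E) FE -(mulmxA E) Xp mulmxA Ep.
Qed.

End TypedForms.
End TypeProjections.

(** * The HKT form on (1,0) vectors *)

Section HKTTrace.
Context {R : realType} {m : nat}.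
Local Notation C := R[i].
Variables (I J g : 'M[C]_m) (X : 'I_m -> 'M[C]_m).
Hypotheses (II : I *m I = - 1%:M) (JJ : J *m J = - 1%:M) (JI : J *m I = - (I *m J)).
Hypotheses (gT : g^T = g) (gunit : g \in unitmx).
Hypotheses (gI : I *m g *m I^T = g) (gJ : J *m g *m J^T = g).
Hypotheses (XI : forall j, X j *m I = I *m X j) (XJ : forall j, X j *m J = J *m X j).
Hypotheses (Xg : forall j, X j *m g = g *m (X j)^T).

Variable W : 'M[C]_m.
Hypothesis WE : W = p10 I *m J *m g.

Let combXI u : comb X u *m I = I *m comb X u.
Proof. by rewrite -comb_mulr -comb_mull; apply: eq_bigr => j _; rewrite XI. Qed.

Let combXJ u : comb X u *m J = J *m comb X u.
Proof. by rewrite -comb_mulr -comb_mull; apply: eq_bigr => j _; rewrite XJ. Qed.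

Let combXg u : comb X u *m g = g *m (comb X u)^T.
Proof.
rewrite /comb linear_sum /= mulmx_suml mulmx_sumr; apply: eq_bigr => j _.
by rewrite linearZ /= -scalemxAl -scalemxAr Xg.
Qed.

Let combXp u : comb X u *m p10 I = p10 I *m comb X u.
Proof. exact: p10_comm (combXI u). Qed.

Let isom_skew (E : 'M[C]_m) : E *m E = - 1%:M -> E *m g *m E^T = g -> E *m g = - (g *m E^T).
Proof.
move=> EE Eg; rewrite -[in RHS]Eg -(mulmxA _ E^T) -trmx_mul EE linearN /= trmx1.
by rewrite mulmxN mulmx1 opprK.
Qed.

Let gp10T : g *m (p10 I)^T = p01 I *m g.
Proof.
have -> : (p10 I)^T = 2^-1 *: (1%:M - 'i%C *: I^T).
  by rewrite /p10 linearZ /= linearB /= linearZ /= trmx1.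
rewrite /p01 -scalemxAr -scalemxAl mulmxBr mulmxDl mulmx1 mul1mx -scalemxAr -scalemxAl.
by rewrite (isom_skew II gI) scalerN.
Qed.

Let p10W : p10 I *m W = W.
Proof. by rewrite WE !mulmxA p10_idem. Qed.

Let Wp10T : W *m (p10 I)^T = W.
Proof.
by rewrite WE -(mulmxA _ g) gp10T !mulmxA -(mulmxA (p10 I)) -(p10_mulJ JI) mulmxA p10_idem.
Qed.

Let WX u : comb X u *m W = W *m (comb X u)^T.
Proof. by rewrite WE !mulmxA combXp -(mulmxA _ (comb X u)) combXJ mulmxA -!mulmxA combXg. Qed.

Let WT : W^T = - W.
Proof.
rewrite -{1}Wp10T WE trmx_mul trmxK !trmx_mul gT.
have -> : g *m (J^T *m (p10 I)^T) = - (J *m p01 I *m g).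
  by rewrite mulmxA -[g *m J^T]opprK -(isom_skew JJ gJ) mulNmx -!mulmxA gp10T.
by rewrite mulmxN -(p10_mulJ JI) !mulmxA p10_idem.
Qed.

Let W_inv : exists Z, W *m Z = p10 I /\ Z *m W = (p10 I)^T.
Proof.
exists (- (invmx g *m J)); split.
  by rewrite WE mulmxN mulmxA mulmxK // -mulmxA JJ mulmxN mulmx1 opprK.
have JpJ : J *m p10 I *m J = - p01 I.
  by rewrite -mulmxA (p10_mulJ JI) mulmxA JJ mulNmx mul1mx.
have JW : J *m W = - (p01 I *m g) by rewrite WE !mulmxA JpJ mulNmx.
by rewrite mulNmx -mulmxA JW mulmxN opprK -gp10T mulKmx.
Qed.

(** [W] only sees (1,0) parts, so it equals [F *m (E *m W *m E^T) *m F^T]. The determinant of the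
    middle factor is [d], nonzero since [W] is nondegenerate on (1,0) vectors. *)
Lemma det_hkt_gram q (E : 'M[C]_(q, m)) (F : 'M[C]_(m, q)) :
  F *m E = p10 I -> E *m F = 1%:M ->
  exists2 d : C, d != 0 &
    forall A B : 'M[C]_(q, m), \det (A *m W *m B^T) = d * \det (A *m F) * \det (B *m F).
Proof.
move=> FE EF; have [Z [WZ _]] := W_inv.
exists (\det (E *m W *m E^T)) => [|A B].
  have inv : (E *m W *m E^T) *m (F^T *m Z *m F) = 1%:M.
    have -> : E *m W *m E^T *m (F^T *m Z *m F) = E *m (W *m (F *m E)^T) *m Z *m F.
      by rewrite trmx_mul !mulmxA.
    by rewrite FE Wp10T -(mulmxA E) WZ -FE mulmxA EF mul1mx EF.
  by rewrite -unitfE; move/mulmx1_unit: inv => [].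
have -> : A *m W *m B^T = (A *m F) *m (E *m W *m E^T) *m (B *m F)^T.
  by rewrite -{1}Wp10T -{1}p10W -FE !trmx_mul !mulmxA.
by rewrite !det_mulmx det_tr; ring.
Qed.

Hypothesis closed : forall A : 'M[C]_(3, m),
  ext X (bilinear_form W) (A *m p10 I) = 0.

(* Contracting the (3,0)-part of d Omega with the inverse of Omega. *)
Lemma trace_of_hkt u :
  2%:R * \tr (comb (flip X) (u *m p10 I)) = \tr (comb X (u *m p10 I) *m p10 I).
Proof.
set w := u *m p10 I; set M := comb (flip X) w.
have wp : w *m p10 I = w by rewrite /w -mulmxA p10_idem.
have ME v : v *m M = w *m comb X v by exact: mul_comb_flip.
have Mp : M *m p10 I = M.
  apply/row_matrixP=> i; rewrite rowE mulmxA ME -mulmxA combXp mulmxA wp.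
  by rewrite -ME -rowE.
(* Closedness on [w] and two further (1,0) vectors: differentiating along [w] produces [comb X w],
   along the others [M], by [ME]. Self-adjointness of [X] for [W] gives all terms a common factor
   2. *)
have key (v v' : 'rV[C]_m) :
    v *m p10 I *m (W *m (comb X w)^T - M *m W - W *m M^T) *m (v' *m p10 I)^T = 0.
  have := closed (col_mx u (col_mx v v') : 'M[C]_(3, m)).
  set B := _ *m p10 I.
  have row0 : row 0 B = w by rewrite row_mul row0_col_mx.
  have row1 : row (lift 0 0) B = v *m p10 I.
    by rewrite row_mul -row_row' row'0_col_mx row0_col_mx.
  have row2 : row (lift 0 (lift 0 0)) B = v' *m p10 I.
    rewrite row_mul -row_row' row'0_col_mx -row_row' row'0_col_mx.
    by congr (_ *m _); apply/rowP=> j; rewrite mxE.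
  have act2 Y (D : 'M[C]_(2, m)) : Y *m W = W *m Y^T ->
      act Y (bilinear_form W) D = 2%:R * (row 0 D *m (W *m Y^T) *m (row (lift 0 0) D)^T) 0 0.
    move=> YW; rewrite bilinear_act YW -mulr2n -scaler_nat /bilinear_form -scalemxAr -scalemxAl mxE.
    by rewrite (_ : ord_max = lift 0 0) //; apply: val_inj.
  rewrite /ext 2!big_ord_recl big_ord1 !act2 ?WX // !row_row'.
  have l1 : lift (lift ord0 ord0 : 'I_3) (0 : 'I_2) = 0 by exact: val_inj.
  have l2 : lift (lift ord0 ord0 : 'I_3) (lift 0 0 : 'I_2) = lift 0 (lift 0 0).
    exact: val_inj.
  have l3 : lift (lift ord0 (lift ord0 ord0) : 'I_3) (0 : 'I_2) = 0 by exact: val_inj.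
  have l4 : lift (lift ord0 (lift ord0 ord0) : 'I_3) (lift 0 0 : 'I_2) = lift 0 0.
    exact: val_inj.
  rewrite l1 l2 l3 l4 row0 row1 row2.
  move: (v *m p10 I) (v' *m p10 I) => b b'.
  rewrite -(WX b) -(WX b') !mulmxA -(ME b) -(ME b').
  have -> : (b' *m M *m W *m b^T) 0 0 = - (b *m W *m M^T *m b'^T) 0 0.
    have -> : (b' *m M *m W *m b^T) = (b *m W^T *m M^T *m b'^T)^T.
      by rewrite !trmx_mul !trmxK !mulmxA.
    by rewrite WT mulmxN !mulNmx mxE [LHS]mxE.
  have s1 : (-1) ^+ (lift ord0 ord0 : 'I_3) = -1 :> C by rewrite (_ : nat_of_ord _ = 1%N) ?expr1.
  have s2 : (-1) ^+ (lift ord0 (lift ord0 ord0) : 'I_3) = 1 :> C.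
    by rewrite (_ : nat_of_ord _ = 2%N) // sqrrN expr1n.
  rewrite s1 s2 expr0 !mulmxBr !mulmxBl !mulmxA.
  move: (b *m W *m (comb X w)^T *m b'^T) (b *m M *m W *m b'^T) (b *m W *m M^T *m b'^T) => x y z h.
  apply/matrixP=> i j; rewrite !ord1 !mxE.
  have /eqP : 2%:R * (x 0 0 - y 0 0 - z 0 0) = 0 by rewrite -[RHS]h; ring.
  by rewrite mulf_eq0 pnatr_eq0 /= => /eqP.
have {}key : W *m (comb X w)^T - p10 I *m M *m W - W *m M^T *m (p10 I)^T = 0.
  have pW : p10 I *m (W *m (comb X w)^T - M *m W - W *m M^T) *m (p10 I)^T
      = W *m (comb X w)^T - p10 I *m M *m W - W *m M^T *m (p10 I)^T.
    rewrite !mulmxBr !mulmxBl !mulmxA p10W; congr (_ - _ - _).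
      by rewrite -mulmxA -trmx_mul -combXp trmx_mul mulmxA Wp10T.
    by rewrite -mulmxA Wp10T.
  rewrite -pW; apply/matrixP=> i j; rewrite [RHS]mxE.
  have := key (delta_mx 0 i) (delta_mx 0 j).
  move=> /matrixP /(_ 0 0); rewrite [RHS]mxE => h.
  have e (N : 'M[C]_m) : N i j = (delta_mx (0 : 'I_1) i *m N *m delta_mx j (0 : 'I_1)) 0 0.
    by rewrite -rowE -colE !mxE.
  by rewrite e -[RHS]h trmx_mul trmx_delta !mulmxA.
(* Contract with the inverse [Z] of [W] on (1,0) vectors: the three terms become the trace of
   [comb X w *m p10 I] and twice that of [M]. *)
have [Z [WZ ZW]] := W_inv.
have : \tr ((W *m (comb X w)^T - p10 I *m M *m W - W *m M^T *m (p10 I)^T) *m Z) = 0.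
  by rewrite key mul0mx linear0.
rewrite !mulmxBl !linearB /=.
have -> : \tr (W *m (comb X w)^T *m Z) = \tr (comb X w *m p10 I).
  by rewrite mxtrace_mulC mulmxA ZW -trmx_mul mxtrace_tr.
have -> : \tr (p10 I *m M *m W *m Z) = \tr M.
  by rewrite -(mulmxA _ W) WZ mxtrace_mulC mulmxA p10_idem // mxtrace_mulC Mp.
have -> : \tr (W *m M^T *m (p10 I)^T *m Z) = \tr M.
  rewrite -!mulmxA mxtrace_mulC -!mulmxA ZW -!trmx_mul mxtrace_tr.
  by rewrite p10_idem // mxtrace_mulC Mp.
by move/eqP; rewrite -addrA -opprD subr_eq0 => /eqP ->; ring.
Qed.

End HKTTrace.

(** * Vanishing of the traces at a point *)

Section AtAPoint.
Context {R : realType}.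
Local Notation C := R[i].
Local Notation form := (Defs.form R).
Local Notation multilinear := Defs.multilinear.
Local Notation alternating := Defs.alternating.

Lemma ext_coclosed_form m k (W : 'M[C]_m) (be : form m k) (X : 'I_m -> 'M[C]_m) :
  m = k.+2 -> (0 < k)%N -> W^T = - W -> W \in unitmx ->
  multilinear be -> alternating be ->
  (forall Y, Y *m W + W *m Y^T = 0 -> forall A, act Y be A = 0) ->
  (forall j, W *m (X j)^T = X j *m W) -> (forall j, \tr (X j) = 0) ->
  (forall v, \tr (comb (flip X) v) = 0) -> forall A, ext X be A = 0.
Proof.
case: k be => // k be mk; subst m => _ WT Wu ml al inv WX trX trF A.
exact: (ext_coclosed WT ml al inv WX trX trF Wu).
Qed.

Lemma cmxM p q r (A : 'M[R]_(p, q)) (B : 'M[R]_(q, r)) : cmx (A *m B) = cmx A *m cmx B.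
Proof. exact: map_mxM. Qed.

Lemma cmxT p q (A : 'M[R]_(p, q)) : cmx A^T = (cmx A)^T.
Proof. exact: esym (map_trmx _ _). Qed.

Lemma cmxN p q (A : 'M[R]_(p, q)) : cmx (- A) = - cmx A.
Proof. by rewrite /cmx map_mxN. Qed.

Lemma cmxD p q (A B : 'M[R]_(p, q)) : cmx (A + B) = cmx A + cmx B.
Proof. by rewrite /cmx map_mxD. Qed.

Lemma cmx1 p : cmx (1%:M : 'M[R]_p) = 1%:M.
Proof. exact: map_mx1. Qed.

Lemma mxtrace_cmx m (A : 'M[R]_m) : \tr (cmx A) = real_complex R (\tr A).
Proof. by rewrite /mxtrace rmorph_sum; apply: eq_bigr => i _; rewrite mxE. Qed.

Lemma mxtrace_comb m (X : 'I_m -> 'M[C]_m) u :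
  \tr (comb X u) = \sum_j u 0 j * \tr (X j).
Proof. by rewrite /comb linear_sum; apply: eq_bigr => j _; rewrite linearZ. Qed.

(** Taking real parts, a real functional vanishing on all (0,1) vectors ([c = 1]) or on all (1,0)
    vectors ([c = -1]) is zero. *)
Lemma real_functional_eq0 m (I : 'M[R]_m) (s : 'I_m -> R) (c : R) :
  (forall j, \sum_l (delta_mx (0 : 'I_1) j
       *m (2^-1 *: (1%:M + (real_complex R c * 'i%C) *: cmx I))) 0 l * real_complex R (s l) = 0) ->
  forall j, s j = 0.
Proof.
move=> h j; have := h j.
pose y := \sum_l I j l * s l.
suff -> : \sum_l (delta_mx (0 : 'I_1) j
       *m (2^-1 *: (1%:M + (real_complex R c * 'i%C) *: cmx I))) 0 l
       * real_complex R (s l) = 2^-1 * (s j +i* (c * y))%C.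
  move/eqP; rewrite mulf_eq0 invr_eq0 pnatr_eq0 /= eq_complex /= => /andP[/eqP -> //].
transitivity (\sum_l (2^-1 * ((j == l)%:R * real_complex R (s l)
    + (real_complex R c * 'i%C) * real_complex R (I j l * s l)))).
  apply: eq_bigr => l _; rewrite -rowE !mxE rmorphM /=; ring.
rewrite -mulr_sumr big_split /=; congr (_ * _).
rewrite (bigD1 j) //= eqxx mul1r big1 ?addr0 => [|l jl]; last first.
  by rewrite eq_sym (negbTE jl) mul0r.
rewrite -mulr_sumr -rmorph_sum /= -/y.
by apply/eqP; rewrite eq_complex /=; apply/andP; split; apply/eqP; rewrite /=; ring.
Qed.

Definition hkt_matrix m (J K g : 'M[R]_m) : 'M[C]_m :=
  2^-1 *: (cmx (J *m g) + 'i%C *: cmx (K *m g)).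

Lemma hkt_matrixE m (I J g : 'M[R]_m) : J *m I = - (I *m J) ->
  hkt_matrix J (J *m I) g = p10 (cmx I) *m cmx J *m cmx g.
Proof.
move=> JI; rewrite /hkt_matrix /p10 -!scalemxAl JI !cmxM cmxN !cmxM mulNmx scalerN.
by congr (_ *: _); rewrite mulmxBl mul1mx -!scalemxAl mulmxBl -scalemxAl.
Qed.

Variables (m q k : nat).
Hypotheses (mq : m = q.*2) (mk : m = k.+2) (k_gt0 : (0 < k)%N).
Variables (I J g : 'M[R]_m) (X : 'I_m -> 'M[R]_m).
Hypotheses (II : I *m I = - 1%:M) (JJ : J *m J = - 1%:M) (JI : J *m I = - (I *m J)).
Hypotheses (gT : g^T = g) (gunit : g \in unitmx).
Hypotheses (gI : I *m g *m I^T = g) (gJ : J *m g *m J^T = g).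
Hypotheses (XI : forall j, X j *m I = I *m X j) (XJ : forall j, X j *m J = J *m X j).
Hypotheses (Xg : forall j, X j *m g = g *m (X j)^T).

Let Xc j := cmx (X j).
Let IIc : cmx I *m cmx I = - 1%:M. Proof. by rewrite -cmxM II cmxN cmx1. Qed.
Let JJc : cmx J *m cmx J = - 1%:M. Proof. by rewrite -cmxM JJ cmxN cmx1. Qed.
Let JIc : cmx J *m cmx I = - (cmx I *m cmx J). Proof. by rewrite -!cmxM JI cmxN. Qed.
Let XIc j : Xc j *m cmx I = cmx I *m Xc j. Proof. by rewrite -!cmxM XI. Qed.
Let XJc j : Xc j *m cmx J = cmx J *m Xc j. Proof. by rewrite -!cmxM XJ. Qed.

Let trXI u : \tr (comb Xc u *m p10 (cmx I)) = 2^-1 * \tr (comb Xc u).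
Proof.
apply: mxtrace_mul_p10; apply: (mxtrace_mulI JJc JIc).
by rewrite -comb_mulr -comb_mull; apply: eq_bigr => j _; rewrite XJc.
Qed.

Lemma trace_eq0_of_q0_form (a : form m q) :
  multilinear a -> alternating a -> (forall A, a A = type_part I q a A) ->
  (exists A, a A <> 0) -> (forall A, type_part I q (ext Xc a) A = 0) ->
  forall j, \tr (X j) = 0.
Proof.
move=> ml al ty [A0 aA0] da.
have [E [F [FE EF]]] := p10_factor IIc JJc JIc mq.
have aE : a E != 0.
  apply/eqP => aE; apply: aA0.
  by rewrite (type_q0_det ml al ty FE) aE mulr0.
apply: (@real_functional_eq0 _ I _ 1) => j.
have /eqP := da (col_mx (delta_mx (0 : 'I_1) j *m p01 (cmx I)) E).
rewrite (trace_of_delbar_q0 IIc _ ml al ty XIc FE EF) mulf_eq0 (negbTE aE) orbF.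
rewrite trXI mulf_eq0 invr_eq0 pnatr_eq0 /= mxtrace_comb => /eqP h; rewrite -[RHS]h.
by apply: eq_bigr => l _; rewrite rmorph1 mul1r -mxtrace_cmx.
Qed.

(** The right-hand side of [trace_of_hkt] is a trace over (1,0) vectors, which is half of the full
    trace of [X] and so zero. *)
Lemma flip_trace_eq0_of_hkt :
  (forall j, \tr (X j) = 0) ->
  (forall A, type_part I 3 (ext Xc (bilinear_form (hkt_matrix J (J *m I) g))) A = 0) ->
  forall v, \tr (comb (flip Xc) v) = 0.
Proof.
move=> trX dOmega.
have t0 u : \tr (comb (flip Xc) (u *m p10 (cmx I))) = 0.
  have closed A : ext Xc (bilinear_form (hkt_matrix J (J *m I) g)) (A *m p10 (cmx I)) = 0.
    by rewrite -type_part_full.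
  have := @trace_of_hkt R m (cmx I) (cmx J) (cmx g) Xc IIc JJc JIc.
  rewrite -!cmxT -!cmxM gT gI gJ.
  move=> /(_ erefl _ erefl erefl XIc XJc _ _ (hkt_matrixE g JI) closed u).
  rewrite map_unitmx => /(_ gunit) h.
  have /eqP : 2%:R * \tr (comb (flip Xc) (u *m p10 (cmx I))) = 0.
    rewrite h => [|j]; last by rewrite -!cmxT -!cmxM Xg.
    by rewrite trXI mxtrace_comb big1 ?mulr0 // => l _; rewrite mxtrace_cmx trX mulr0.
  by rewrite mulf_eq0 pnatr_eq0 /= => /eqP.
have flipE j : flip Xc j = cmx (flip X j) by apply/matrixP=> a b; rewrite !mxE.
have s0 : forall j, \tr (flip X j) = 0.
  apply: (@real_functional_eq0 _ I _ (-1)) => j; rewrite -[RHS](t0 (delta_mx 0 j)) mxtrace_comb.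
  by apply: eq_bigr => l _; rewrite flipE mxtrace_cmx rmorphN rmorph1 mulN1r scaleNr.
by move=> v; rewrite mxtrace_comb big1 // => l _; rewrite flipE mxtrace_cmx s0 mulr0.
Qed.

Lemma ext_wedge_pow_eq0 (p : nat) : p.*2 = k ->
  (forall j, \tr (X j) = 0) -> (forall v, \tr (comb (flip Xc) v) = 0) ->
  forall A, ext Xc (wedge_pow (bilinear_form (cmx (I *m g))) p) A = 0.
Proof.
move=> pk trX trF.
have WT : (cmx (I *m g))^T = - cmx (I *m g).
  rewrite -cmxT -cmxN; congr cmx.
  by rewrite trmx_mul gT -[in RHS]gI !mulmxA II !mulNmx mul1mx opprK.
have Iu : I \in unitmx.
  have : I *m (- I) = 1%:M by rewrite mulmxN II opprK.
  by case/mulmx1_unit.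
apply: (ext_coclosed_form (W := cmx (I *m g))); rewrite ?pk //.
- by rewrite map_unitmx unitmx_mul Iu.
- exact/wedge_pow_multilinear/bilinear_multilinear.
- exact: wedge_pow_alternating.
- move=> Y YW A; apply: act_wedge_pow_eq0 => {}A.
  by rewrite bilinear_act YW /bilinear_form mulmx0 mul0mx mxE.
- move=> j; rewrite -cmxT -!cmxM; congr cmx.
  by rewrite !mulmxA XI -!mulmxA Xg.
- by move=> j; rewrite mxtrace_cmx trX.
Qed.

End AtAPoint.

(** * Derivatives of tensors in coordinates *)

Section ComplexDerivatives.
Context {R : realType} {m : nat}.
Local Notation C := R[i].
Local Notation form := (Defs.form R m).
Local Notation multilinear := Defs.multilinear.
Implicit Types (x v : 'rV[R]_m).

Definition cder (f : 'rV[R]_m -> C) x v (l : C) :=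
  is_derive x v (Re_fun f) (complex.Re l) /\ is_derive x v (Im_fun f) (complex.Im l).

Lemma cder_real (f : 'rV[R]_m -> R) x v l :
  is_derive x v f l -> cder (fun y => real_complex R (f y)) x v (real_complex R l).
Proof. by move=> h; split=> //=; exact: is_derive_cst. Qed.

Lemma cder_cst (c : C) x v : cder (fun=> c) x v 0.
Proof. by split; exact: is_derive_cst. Qed.

Lemma cderD f g x v l l' : cder f x v l -> cder g x v l' ->
  cder (fun y => f y + g y) x v (l + l').
Proof.
move=> [f1 f2] [g1 g2]; split.
  have -> : Re_fun (fun y => f y + g y) = Re_fun f + Re_fun g.
    by apply/funext => y; rewrite /Re_fun fctE; case: (f y); case: (g y).
  have -> : complex.Re (l + l') = complex.Re l + complex.Re l' by case: l {f1 f2}; case: l' {g1 g2}.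
  exact: is_deriveD.
have -> : Im_fun (fun y => f y + g y) = Im_fun f + Im_fun g.
  by apply/funext => y; rewrite /Im_fun fctE; case: (f y); case: (g y).
have -> : complex.Im (l + l') = complex.Im l + complex.Im l' by case: l {f1 f2}; case: l' {g1 g2}.
exact: is_deriveD.
Qed.

Lemma cderM f g x v l l' : cder f x v l -> cder g x v l' ->
  cder (fun y => f y * g y) x v (l * g x + f x * l').
Proof.
move=> [f1 f2] [g1 g2]; split.
  have -> : Re_fun (fun y => f y * g y) = Re_fun f * Re_fun g - Im_fun f * Im_fun g.
    by apply/funext => y; rewrite /Re_fun /Im_fun !fctE; case: (f y); case: (g y).
  apply: is_derive_eq (is_deriveB (is_deriveM f1 g1) (is_deriveM f2 g2)) _.
  rewrite /Re_fun /Im_fun; case: l {f1 f2} => a b; case: l' {g1 g2} => c d.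
  by case: (f x) => ? ?; case: (g x) => ? ? /=; rewrite /GRing.scale /=; ring.
have -> : Im_fun (fun y => f y * g y) = Re_fun f * Im_fun g + Im_fun f * Re_fun g.
  by apply/funext => y; rewrite /Re_fun /Im_fun !fctE; case: (f y); case: (g y).
apply: is_derive_eq (is_deriveD (is_deriveM f1 g2) (is_deriveM f2 g1)) _.
rewrite /Re_fun /Im_fun; case: l {f1 f2} => a b; case: l' {g1 g2} => c d.
by case: (f x) => ? ?; case: (g x) => ? ? /=; rewrite /GRing.scale /=; ring.
Qed.

Lemma cderMl (c : C) f x v l : cder f x v l -> cder (fun y => c * f y) x v (c * l).
Proof. by move=> h; have := cderM (cder_cst c x v) h; rewrite mul0r add0r. Qed.

Lemma cder_sum (I : Type) (r : seq I) (P : pred I) (f : I -> 'rV[R]_m -> C) x v (l : I -> C) :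
  (forall i, P i -> cder (f i) x v (l i)) ->
  cder (fun y => \sum_(i <- r | P i) f i y) x v (\sum_(i <- r | P i) l i).
Proof.
move=> h; elim: r => [|i r IH].
  under eq_fun do rewrite big_nil; rewrite big_nil; exact: cder_cst.
under eq_fun do rewrite big_cons; rewrite big_cons.
by case: ifP => // Pi; apply: cderD => //; apply: h.
Qed.

Lemma cder_unique f x v l l' : cder f x v l -> cder f x v l' -> l = l'.
Proof.
move=> [f1 f2] [g1 g2]; apply/eqP; rewrite eq_complex; apply/andP; split; apply/eqP.
  by rewrite -(@derive_val _ _ _ _ _ _ _ f1) (@derive_val _ _ _ _ _ _ _ g1).
by rewrite -(@derive_val _ _ _ _ _ _ _ f2) (@derive_val _ _ _ _ _ _ _ g2).
Qed.

Lemma cder_near f g x v l : (\forall y \near x, f y = g y) -> cder f x v l -> cder g x v l.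
Proof.
move=> fg [f1 f2]; split.
  by apply: near_eq_is_derive f1; apply: filterS fg => y fgy; rewrite /Re_fun fgy.
by apply: near_eq_is_derive f2; apply: filterS fg => y fgy; rewrite /Im_fun fgy.
Qed.

Lemma cderiveE f x (w : 'rV[C]_m) (l : 'I_m -> C) :
  (forall j, cder f x (delta_mx 0 j) (l j)) -> cderive f x w = \sum_j w 0 j * l j.
Proof.
move=> h; apply: eq_bigr => j _; congr (_ * _).
have [f1 f2] := h j.
rewrite (@derive_val _ _ _ _ _ _ _ f1) (@derive_val _ _ _ _ _ _ _ f2).
by case: (l j).
Qed.

End ComplexDerivatives.

Section MatrixDerivatives.
Context {R : realType} {m : nat}.
Local Notation C := R[i].
Local Notation form := (Defs.form R m).
Local Notation multilinear := Defs.multilinear.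
Implicit Types (x v : 'rV[R]_m).

Definition mder p q (E : 'rV[R]_m -> 'M[R]_(p, q)) x v (D : 'M[R]_(p, q)) :=
  forall a b, is_derive x v (fun y => E y a b) (D a b).

Lemma mder_cst p q (A : 'M[R]_(p, q)) x v : mder (fun=> A) x v 0.
Proof. by move=> a b; rewrite mxE; exact: is_derive_cst. Qed.

Lemma mder_trmx p q (E : 'rV[R]_m -> 'M[R]_(p, q)) x v D :
  mder E x v D -> mder (fun y => (E y)^T) x v D^T.
Proof.
by move=> h a b; rewrite mxE; under eq_fun do rewrite mxE; apply: h.
Qed.

Lemma mderM p q r (E : 'rV[R]_m -> 'M[R]_(p, q)) (F : 'rV[R]_m -> 'M[R]_(q, r)) x v D D' :
  mder E x v D -> mder F x v D' ->
  mder (fun y => E y *m F y) x v (D *m F x + E x *m D').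
Proof.
move=> hE hF a b.
have -> : (fun y => (E y *m F y) a b) = \sum_c (fun y => E y a c) * (fun y => F y c b).
  by apply/funext=> y; rewrite mxE fct_sumE.
rewrite !mxE -big_split.
apply: is_derive_eq (is_derive_sum (fun c => is_deriveM (hE a c) (hF c b))) _.
by apply: eq_bigr => c _; rewrite addrC; congr (_ + _); apply: mulrC.
Qed.

Lemma mderN p q (E : 'rV[R]_m -> 'M[R]_(p, q)) x v D :
  mder E x v D -> mder (fun y => - E y) x v (- D).
Proof.
move=> h a b; rewrite mxE; under eq_fun do rewrite mxE.
exact: (@is_deriveN _ _ _ (fun y => E y a b)).
Qed.

Lemma mder_unique p q (E F : 'rV[R]_m -> 'M[R]_(p, q)) x v D D' :
  (\forall y \near x, E y = F y) -> mder E x v D -> mder F x v D' -> D = D'.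
Proof.
move=> EF hE hF; apply/matrixP=> a b.
rewrite -(@derive_val _ _ _ _ _ _ _ (hE a b)) -(@derive_val _ _ _ _ _ _ _ (hF a b)).
by apply: near_eq_derive; apply: filterS EF => y ->.
Qed.

Lemma mder_derive p q (E : 'rV[R]_m -> 'M[R]_(p, q)) x v D :
  mder E x v D -> 'D_v E x = D.
Proof.
move=> h; rewrite derive_mx; last first.
  by apply/derivable_mxP => a b; have := h a b => -[].
by apply/matrixP=> a b; rewrite mxE (@derive_val _ _ _ _ _ _ _ (h a b)).
Qed.

Lemma smooth_fun_differentiable (U : set 'rV[R]_m) (f : 'rV[R]_m -> R) x :
  smooth_fun_on U f -> U x -> differentiable f x.
Proof.
move=> /(_ [::] x) /= h Ux.
have -> : f = (fun M : 'rV[R]_1 => M 0 0) \o (fun y => \row_(_ < 1) f y).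
  by apply/funext=> y; rewrite /= mxE.
by apply: differentiable_comp; [exact: h | exact: differentiable_coord].
Qed.

Definition mpartial p q (E : 'rV[R]_m -> 'M[R]_(p, q)) x (j : 'I_m) : 'M[R]_(p, q) :=
  \matrix_(a, b) 'D_(delta_mx 0 j) (fun y => E y a b) x.

Lemma mder_mpartial p q (E : 'rV[R]_m -> 'M[R]_(p, q)) x j :
  (forall a b, differentiable (fun y => E y a b) x) ->
  mder E x (delta_mx 0 j) (mpartial E x j).
Proof. by move=> h a b; rewrite mxE; apply/derivableP/diff_derivable. Qed.

Lemma mder_comb (E : 'rV[R]_m -> 'M[R]_m) x u :
  (forall a b, differentiable (fun y => E y a b) x) ->
  mder E x u (comb (mpartial E x) u).
Proof.
move=> h a b; have -> : comb (mpartial E x) u a b = 'D_u (fun y => E y a b) x.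
  rewrite deriveE // {2}(row_sum_delta u) linear_sum summxE; apply: eq_bigr => j _.
  by rewrite linearZ !mxE /= deriveE.
by apply/derivableP/diff_derivable.
Qed.

Lemma nijenhuisE (E : 'rV[R]_m -> 'M[R]_m) x u v :
  (forall a b, differentiable (fun y => E y a b) x) ->
  nijenhuis E x u v = nijenhuis_of (E x) (mpartial E x) u v.
Proof.
move=> h; rewrite /nijenhuis /vbracket.
have e (w z : 'rV[R]_m) : 'D_z (fun y => w *m E y) x = w *m comb (mpartial E x) z.
  apply: mder_derive; have := mderM (mder_cst w x z) (mder_comb z h).
  by rewrite mul0mx add0r.
by rewrite !derive_cst !e /nijenhuis_of !sub0r !subr0 mulNmx opprK !oppr0 addr0.
Qed.

(** The passage from analysis to algebra: the hypothesis says that [a] is parallel at [x] for the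
    connection [Y]. *)
Lemma extdE k (a : 'rV[R]_m -> form k) (Y : 'I_m -> 'M[C]_m) x : multilinear (a x) ->
  (forall j B, cder (fun y => a y B) x (delta_mx 0 j) (act (Y j) (a x) B)) ->
  forall A, extd a x A = ext Y (a x) A.
Proof.
move=> ml h A; apply: eq_bigr => r _; congr (_ * _).
by rewrite (cderiveE _ (fun j => h j (row' r A))) act_comb.
Qed.

Lemma cder_wedge p q (a : 'rV[R]_m -> form p) (b : 'rV[R]_m -> form q) (Y : 'M[C]_m) x v :
  (forall B, cder (fun y => a y B) x v (act Y (a x) B)) ->
  (forall B, cder (fun y => b y B) x v (act Y (b x) B)) ->
  forall B, cder (fun y => wedge (a y) (b y) B) x v (act Y (wedge (a x) (b x)) B).
Proof.
move=> ha hb B; rewrite act_wedge /wedge -mulrDr -big_split.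
apply: cderMl; apply: cder_sum => s _ /=; rewrite -mulrDr; apply: cderMl.
exact: cderM.
Qed.

Lemma cder_wedge_pow (w : 'rV[R]_m -> form 2) (Y : 'M[C]_m) x v k :
  (forall B, cder (fun y => w y B) x v (act Y (w x) B)) ->
  forall B, cder (fun y => wedge_pow (w y) k B) x v (act Y (wedge_pow (w x) k) B).
Proof.
move=> h; elim: k => [|k IH] B; last exact: (@cder_wedge 2 k.*2).
by rewrite /act big_ord0; exact: cder_cst.
Qed.

Lemma cder_bilinear_form (W : 'rV[R]_m -> 'M[C]_m) (W' : 'M[C]_m) x v :
  (forall a b, cder (fun y => W y a b) x v (W' a b)) ->
  forall B, cder (fun y => bilinear_form (W y) B) x v (bilinear_form W' B).
Proof.
move=> h B; rewrite /bilinear_form mxE; under eq_fun do rewrite mxE.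
apply: cder_sum => j _.
under eq_fun do rewrite mulrC; rewrite mulrC; apply: cderMl.
rewrite mxE; under eq_fun do rewrite mxE.
by apply: cder_sum => i _; apply: cderMl.
Qed.

Lemma cder_cmx p q (E : 'rV[R]_m -> 'M[R]_(p, q)) x v D : mder E x v D ->
  forall a b, cder (fun y => cmx (E y) a b) x v (cmx D a b).
Proof. by move=> h a b; rewrite mxE; under eq_fun do rewrite mxE; apply: cder_real. Qed.

End MatrixDerivatives.

(** * Derivatives of determinants and parallelism of the canonical section *)

Section DeterminantDerivative.
Context {R : realType} {m : nat}.
Local Notation C := R[i].
Local Notation form := (Defs.form R).
Local Notation multilinear := Defs.multilinear.
Local Notation alternating := Defs.alternating.

Lemma det_multilinear q : @Defs.multilinear R q q (@determinant C q).
Proof.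
move=> r A B D b d hA hB hD; exact: determinant_multilinear hA hB hD.
Qed.

(** Varying [M] row by row or column by column gives the same derivative of the determinant: both
    sides pair the entries of [N] with the cofactors of [M]. *)
Lemma sum_det_upd_trmx q (M N : 'M[C]_q) :
  \sum_r \det (upd M r (row r N)) = \sum_r \det (upd M^T r (row r N^T)).
Proof.
have e (M' N' : 'M[C]_q) r : \det (upd M' r (row r N')) = \sum_c N' r c * cofactor M' r c.
  rewrite (expand_det_row _ r); apply: eq_bigr => c _; rewrite !mxE eqxx.
  rewrite /cofactor; congr (_ * (_ * \det _)); apply/matrixP=> i j.
  by rewrite !mxE eq_sym (negbTE (neq_lift _ _)).
under eq_bigr do rewrite e; rewrite exchange_big; apply: eq_bigr => r _.
by rewrite e; apply: eq_bigr => c _; rewrite mxE cofactor_tr.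
Qed.

Lemma cder_prod (I : finType) (f : I -> 'rV[R]_m -> C) x v (l : I -> C) :
  (forall i, cder (f i) x v (l i)) ->
  cder (fun y => \prod_i f i y) x v (\sum_r \prod_i (if i == r then l i else f i x)).
Proof.
move=> h.
suff H (s : seq I) : uniq s -> cder (fun y => \prod_(i <- s) f i y) x v
    (\sum_(r <- s) \prod_(i <- s) (if i == r then l i else f i x)).
  by apply: H; exact: index_enum_uniq.
elim: s => [_|i s IH /= /andP[nis us]].
  rewrite big_nil; under eq_fun do rewrite big_nil; exact: cder_cst.
under eq_fun do rewrite big_cons.
have := cderM (h i) (IH us); rewrite big_cons; congr (cder _ _ _ _).
rewrite big_cons eqxx mulr_sumr; congr (_ * _ + _).
  by apply: eq_big_seq => k ks; case: eqP => // ki; rewrite -ki ks in nis.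
apply: eq_big_seq => r rs; rewrite big_cons; case: eqP => // ri.
by rewrite ri rs in nis.
Qed.

Lemma cder_det q (M : 'rV[R]_m -> 'M[C]_q) (M' : 'M[C]_q) x v :
  (forall a b, cder (fun y => M y a b) x v (M' a b)) ->
  cder (fun y => \det (M y)) x v (\sum_r \det (upd (M x) r (row r M'))).
Proof.
move=> h; rewrite /determinant exchange_big /=.
apply: cder_sum => s _; rewrite -mulr_sumr; apply: cderMl.
have := cder_prod (fun i => h i (s i)); congr (cder _ _ _ _).
apply: eq_bigr => r _; apply: eq_bigr => i _; rewrite mxE.
by case: eqP => // ->; rewrite mxE.
Qed.

Lemma cder_mulmx_const p q r (M : 'rV[R]_m -> 'M[C]_(p, q)) (M' : 'M[C]_(p, q)) x v
    (A : 'M[C]_(r, p)) (B : 'M[C]_(q, r)) :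
  (forall a b, cder (fun y => M y a b) x v (M' a b)) ->
  forall a b, cder (fun y => (A *m M y *m B) a b) x v ((A *m M' *m B) a b).
Proof.
move=> h a b; rewrite mxE; under eq_fun do rewrite mxE.
apply: cder_sum => j _; under eq_fun do rewrite mulrC; rewrite mulrC; apply: cderMl.
rewrite mxE; under eq_fun do rewrite mxE.
by apply: cder_sum => i _; apply: cderMl.
Qed.

(* The identity [a(A) a(B) = c det (A W B^T)] transfers the invariance of W   *)
(* to that of a, as it determines a up to sign.                                *)
Lemma cder_of_gram k q (a : 'rV[R]_m -> form k q) (W : 'rV[R]_m -> 'M[C]_k) (Y : 'M[C]_k) c x v
    (D : 'M[C]_(q, k) -> C) :
  (\forall y \near x, forall A B, a y A * a y B = c * \det (A *m W y *m B^T)) ->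
  (forall i j, cder (fun y => W y i j) x v ((Y *m W x + W x *m Y^T) i j)) ->
  (exists A, a x A <> 0) ->
  (forall A, cder (fun y => a y A) x v (D A)) ->
  forall A, cder (fun y => a y A) x v (act Y (a x) A).
Proof.
move=> gram dW [A0 /eqP A0x] dD.
have gramx : forall A B, a x A * a x B = c * \det (A *m W x *m B^T).
  exact: nbhs_singleton gram.
suff DE : forall A, D A = act Y (a x) A by move=> A; rewrite -DE.
(* Differentiate the Gram identity: the factor [Y] on the left of [W] is absorbed by [A] and varies
   rows, the one on the right is absorbed by [B] and varies columns. *)
have key A B : D A * a x B + a x A * D B = act Y (a x) A * a x B + a x A * act Y (a x) B.
  apply: (@cder_unique R m (fun y => a y A * a y B) x v); first exact: cderM.
  apply: (@cder_near R m (fun y => c * \det (A *m W y *m B^T))).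
    by apply: filterS gram => y ->.
  have := cderMl c (cder_det (cder_mulmx_const A B^T dW)); congr (cder _ _ _ _).
  set M := A *m W x *m B^T.
  have -> : A *m (Y *m W x + W x *m Y^T) *m B^T
      = A *m Y *m W x *m B^T + A *m W x *m (B *m Y)^T.
    by rewrite mulmxDr mulmxDl trmx_mul !mulmxA.
  set N1 := A *m Y *m _ *m _; set N2 := A *m _ *m _.
  transitivity (c * (\sum_r \det (upd M r (row r N1)) + \sum_r \det (upd M r (row r N2)))).
    rewrite -big_split; congr (_ * _); apply: eq_bigr => r _.
    by rewrite linearD /= (updD (@det_multilinear q)).
  rewrite mulrDr [X in _ + c * X]sum_det_upd_trmx !mulr_sumr /act mulr_suml; congr (_ + _).
    apply: eq_bigr => r _; rewrite gramx !upd_mul; congr (_ * \det (upd _ _ _)).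
    by rewrite /N1 !row_mul.
  apply: eq_bigr => r _; rewrite gramx; congr (_ * _).
  rewrite -[RHS]det_tr /M /N2 !trmx_mul !trmxK !upd_mul; congr (\det (upd _ _ _)).
  by rewrite !row_mul !mulmxA.
(* Taking both arguments equal to [A0], where [a x] is nonzero, settles [A0]; taking only the second
   one equal to [A0] then settles every [A]. *)
have D0 : D A0 = act Y (a x) A0.
  move: (key A0 A0) A0x; move: (D A0) (act Y _ _) (a x A0) => d e z h z0.
  have /eqP : 2%:R * z * (d - e) = 0.
    by rewrite (_ : _ * _ = d * z + z * d - (e * z + z * e)); [rewrite h subrr | ring].
  by rewrite !mulf_eq0 pnatr_eq0 (negbTE z0) /= subr_eq0 => /eqP.
by move=> A; have := key A A0; rewrite D0 => /addIr /(mulIf A0x).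
Qed.

End DeterminantDerivative.

(** * The theorem in a chart *)

Section HyperhermitianFrame.
Context {R : realType} {m : nat}.
Local Notation C := R[i].
Local Notation form := (Defs.form R m).
Local Notation multilinear := Defs.multilinear.
Local Notation alternating := Defs.alternating.

Lemma cmx_comb_sym (G : 'I_m -> 'M[R]_m) :
  (forall u v, v *m comb G u = u *m comb G v) ->
  forall u v : 'rV[C]_m, v *m comb (fun j => cmx (G j)) u = u *m comb (fun j => cmx (G j)) v.
Proof.
move=> sG u v; rewrite -[RHS]mul_comb_flip; congr (_ *m _); apply: eq_bigr => j _.
congr (_ *: _); apply/matrixP=> b c; rewrite !mxE; congr (real_complex R _).
have := sG (delta_mx 0 j) (delta_mx 0 b); rewrite !comb_delta -!rowE.
by move/rowP => /(_ c); rewrite !mxE.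
Qed.

Section Pointwise.
Variables (I J K g : 'rV[R]_m -> 'M[R]_m) (x : 'rV[R]_m).
Hypotheses (dI : forall a b, differentiable (fun y => I y a b) x)
  (dJ : forall a b, differentiable (fun y => J y a b) x)
  (dK : forall a b, differentiable (fun y => K y a b) x)
  (dg : forall a b, differentiable (fun y => g y a b) x).
Hypotheses (II : \forall y \near x, I y *m I y = - 1%:M)
  (JJ : \forall y \near x, J y *m J y = - 1%:M)
  (KE : \forall y \near x, J y *m I y = K y)
  (JI : \forall y \near x, J y *m I y = - (I y *m J y))
  (gT : \forall y \near x, (g y)^T = g y)
  (gI : \forall y \near x, I y *m g y *m (I y)^T = g y)
  (gJ : \forall y \near x, J y *m g y *m (J y)^T = g y).
Hypotheses (nI : forall u v, nijenhuis I x u v = 0)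
  (nJ : forall u v, nijenhuis J x u v = 0)
  (nK : forall u v, nijenhuis K x u v = 0).
Hypothesis gunit : g x \in unitmx.

Let mI j := mder_mpartial j dI.
Let mJ j := mder_mpartial j dJ.
Let mK j := mder_mpartial j dK.
Let mg j := mder_mpartial j dg.

(** The quaternionic and Hermitian identities hold on a neighbourhood of [x], so they may be
    differentiated; the results are the hypotheses of the lemmas on connections. *)
Lemma hyperhermitian_frame : exists G X : 'I_m -> 'M[R]_m,
  (forall u v, v *m comb G u = u *m comb G v) /\
  forall j, [/\ X j *m I x = I x *m X j, X j *m J x = J x *m X j,
    X j *m g x = g x *m (X j)^T &
    [/\ mpartial I x j = (G j + X j) *m I x - I x *m (G j + X j),
        mpartial J x j = (G j + X j) *m J x - J x *m (G j + X j)
      & mpartial g x j = (G j + X j) *m g x + g x *m (G j + X j)^T]].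
Proof.
have sq (E : 'rV[R]_m -> 'M[R]_m) (dE : forall a b, differentiable (fun y => E y a b) x) j :
    (\forall y \near x, E y *m E y = - 1%:M) ->
    mpartial E x j *m E x = - (E x *m mpartial E x j).
  move=> EE; apply/eqP; rewrite -addr_eq0; apply/eqP.
  have mE := mder_mpartial j dE.
  by apply: (mder_unique EE (mderM mE mE)); exact: mder_cst.
have dJI j : mpartial J x j *m I x = - (mpartial I x j *m J x) - I x *m mpartial J x j
    - J x *m mpartial I x j.
  have := mder_unique JI (mderM (mJ j) (mI j)) (mderN (mderM (mI j) (mJ j))).
  by move=> h; apply/esym/eqP; rewrite subr_eq h opprD.
have dKE j : mpartial K x j = mpartial J x j *m I x + J x *m mpartial I x j.
  exact/esym/(mder_unique KE (mderM (mJ j) (mI j)) (mK j)).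
have [Y hY] := exists_quaternionic_connection (nbhs_singleton II) (nbhs_singleton JJ)
  (nbhs_singleton JI) (fun j => sq _ dI j II) (fun j => sq _ dJ j JJ) dJI.
have [|||G [Gs hG]] := obata_connection (nbhs_singleton II) (nbhs_singleton JJ)
    (nbhs_singleton JI) (fun j => (hY j).1) (fun j => (hY j).2).
- by move=> u v; rewrite -nijenhuisE.
- by move=> u v; rewrite -nijenhuisE.
- move=> u v; have -> : (fun j => mpartial J x j *m I x + J x *m mpartial I x j) = mpartial K x.
    by apply/funext=> j; rewrite dKE.
  by rewrite (nbhs_singleton KE) -nijenhuisE.
have dgE (E : 'rV[R]_m -> 'M[R]_m) (dE : forall a b, differentiable (fun y => E y a b) x) j :
    (\forall y \near x, E y *m g y *m (E y)^T = g y) ->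
    mpartial E x j *m g x *m (E x)^T + E x *m mpartial g x j *m (E x)^T
    + E x *m g x *m (mpartial E x j)^T = mpartial g x j.
  move=> Eg; have mE := mder_mpartial j dE; rewrite -mulmxDl.
  exact: (mder_unique Eg (mderM (mderM mE (mg j)) (mder_trmx mE)) (mg j)).
have [|X hX] := hyperhermitian_connection (nbhs_singleton gT) gunit _ (nbhs_singleton II)
  (nbhs_singleton JJ) (nbhs_singleton gI) (nbhs_singleton gJ)
  (fun j => dgE _ dI j gI) (fun j => dgE _ dJ j gJ) (fun j => (hG j).1) (fun j => (hG j).2).
  by move=> j; exact: (mder_unique gT (mder_trmx (mg j)) (mg j)).
by exists G, X.
Qed.
End Pointwise.

End HyperhermitianFrame.

Section BalancedInChart.
Context {R : realType} {m q p : nat}.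
Local Notation C := R[i].
Local Notation form := (Defs.form R m).
Local Notation multilinear := Defs.multilinear.
Local Notation alternating := Defs.alternating.

Variables (I J K g : 'rV[R]_m -> 'M[R]_m) (Theta : 'rV[R]_m -> form q) (x : 'rV[R]_m).
Hypotheses (mq : m = q.*2) (qp : q = p.+1) (p_gt0 : (0 < p)%N).
Hypotheses (dI : forall a b, differentiable (fun y => I y a b) x)
  (dJ : forall a b, differentiable (fun y => J y a b) x)
  (dK : forall a b, differentiable (fun y => K y a b) x)
  (dg : forall a b, differentiable (fun y => g y a b) x)
  (dTheta : forall A, differentiable (Re_fun (fun y => Theta y A)) x /\
                      differentiable (Im_fun (fun y => Theta y A)) x).
Hypotheses (II : \forall y \near x, I y *m I y = - 1%:M)
  (JJ : \forall y \near x, J y *m J y = - 1%:M)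
  (KE : \forall y \near x, J y *m I y = K y)
  (JI : \forall y \near x, J y *m I y = - (I y *m J y))
  (gT : \forall y \near x, (g y)^T = g y)
  (gI : \forall y \near x, I y *m g y *m (I y)^T = g y)
  (gJ : \forall y \near x, J y *m g y *m (J y)^T = g y).
Hypotheses (nI : forall u v, nijenhuis I x u v = 0)
  (nJ : forall u v, nijenhuis J x u v = 0)
  (nK : forall u v, nijenhuis K x u v = 0).
Hypothesis gunit : g x \in unitmx.
Hypotheses (mlTheta : multilinear (Theta x)) (alTheta : alternating (Theta x))
  (tyTheta : forall A, Theta x A = type_part (I x) q (Theta x) A)
  (Theta_neq0 : exists A, Theta x A <> 0)
  (delbarTheta : forall A, type_part (I x) q (extd Theta x) A = 0).
Hypothesis delOmega : forall A, type_part (I x) 3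
  (extd (fun y => bilinear_form (hkt_matrix (J y) (K y) (g y))) x) A = 0.
Variable c : C.
Hypothesis gram : \forall y \near x, forall A B,
  Theta y A * Theta y B = c * \det (A *m hkt_matrix (J y) (K y) (g y) *m B^T).

(** Invariance enters only through [gram], where [c] does not depend on the point: this makes
    [Theta] parallel along with [I], [J], [K] and [g]. *)
Lemma balanced_in_chart A :
  extd (fun y => wedge_pow (bilinear_form (cmx (I y *m g y))) p) x A = 0.
Proof.
have [G [X [Gs hGX]]] := hyperhermitian_frame dI dJ dK dg II JJ KE JI gT gI gJ nI nJ nK gunit.
pose Y j := cmx (G j + X j); pose Gc j := cmx (G j); pose Xc j := cmx (X j).
have YE : Y = fun j => Gc j + Xc j by apply/funext=> j; rewrite /Y cmxD.
have drop_sym k (a : form k) B : multilinear a -> alternating a -> ext Y a B = ext Xc a B.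
  by move=> ml al; rewrite YE extD // (ext_sym ml al (cmx_comb_sym Gs)) add0r.
have lower (E : 'rV[R]_m -> 'M[R]_m) j :
    (forall a b, differentiable (fun y => E y a b) x) ->
    mpartial E x j = (G j + X j) *m E x - E x *m (G j + X j) ->
    mder (fun y => E y *m g y) x (delta_mx 0 j)
      ((G j + X j) *m (E x *m g x) + (E x *m g x) *m (G j + X j)^T).
  move=> dE Ej; have [_ _ _ [_ _ gj]] := hGX j.
  have := mderM (mder_mpartial j dE) (mder_mpartial j dg); rewrite Ej gj.
  by congr (mder _ _ _ _); rewrite mulmxBl mulmxDr !mulmxA addrA subrK.
have Kj j : mpartial K x j = (G j + X j) *m K x - K x *m (G j + X j).
  have [_ _ _ [Ij Jj _]] := hGX j.
  rewrite -(mder_unique KE (mderM (mder_mpartial j dJ) (mder_mpartial j dI)) (mder_mpartial j dK)).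
  by rewrite Ij Jj -(nbhs_singleton KE) mulmxBl mulmxBr !mulmxA addrA subrK.
have cder_c (E : 'rV[R]_m -> 'M[R]_m) j :
    (forall a b, differentiable (fun y => E y a b) x) ->
    mpartial E x j = (G j + X j) *m E x - E x *m (G j + X j) ->
    forall a b, cder (fun y => cmx (E y *m g y) a b) x (delta_mx 0 j)
      ((Y j *m cmx (E x *m g x) + cmx (E x *m g x) *m (Y j)^T) a b).
  move=> dE Ej a b; have := cder_cmx (lower E j dE Ej) a b.
  by rewrite cmxD [cmx (_ *m (E x *m g x))]cmxM [cmx (E x *m g x *m _)]cmxM cmxT.
have omega_inv j B : cder (fun y => bilinear_form (cmx (I y *m g y)) B) x (delta_mx 0 j)
    (act (Y j) (bilinear_form (cmx (I x *m g x))) B).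
  rewrite bilinear_act; apply: cder_bilinear_form; apply: cder_c => //.
  by have [_ _ _ []] := hGX j.
pose W y := hkt_matrix (J y) (K y) (g y).
have dW j a b : cder (fun y => W y a b) x (delta_mx 0 j) ((Y j *m W x + W x *m (Y j)^T) a b).
  have Jj : mpartial J x j = (G j + X j) *m J x - J x *m (G j + X j) by have [_ _ _ []] := hGX j.
  have hJ := cder_c J j dJ Jj a b; have hK := cder_c K j dK (Kj j) a b.
  have -> : (Y j *m W x + W x *m (Y j)^T) a b = 2^-1 *
      ((Y j *m cmx (J x *m g x) + cmx (J x *m g x) *m (Y j)^T) a b
       + 'i%C * (Y j *m cmx (K x *m g x) + cmx (K x *m g x) *m (Y j)^T) a b).
    rewrite /W /hkt_matrix -scalemxAr -scalemxAl mulmxDr mulmxDl -scalemxAr -scalemxAl.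
    move: (Y j *m cmx (J x *m g x)) (Y j *m cmx (K x *m g x)) => a1 a2.
    move: (cmx (J x *m g x) *m (Y j)^T) (cmx (K x *m g x) *m (Y j)^T) => a3 a4.
    by rewrite !mxE; ring.
  have -> : (fun y => W y a b) =
      (fun y => 2^-1 * (cmx (J y *m g y) a b + 'i%C * cmx (K y *m g y) a b)).
    by apply/funext=> y; rewrite [LHS]mxE [X in _ * X]mxE [X in _ * (_ + X)]mxE.
  by apply: cderMl; apply: cderD => //; apply: cderMl.
have Omega_inv j B : cder (fun y => bilinear_form (W y) B) x (delta_mx 0 j)
    (act (Y j) (bilinear_form (W x)) B).
  by rewrite bilinear_act; apply: cder_bilinear_form; apply: dW.
have Theta_inv j B : cder (fun y => Theta y B) x (delta_mx 0 j) (act (Y j) (Theta x) B).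
  apply: (cder_of_gram gram (dW j) Theta_neq0
    (D := fun A => ('D_(delta_mx 0 j) (Re_fun (fun y => Theta y A)) x +i*
                    'D_(delta_mx 0 j) (Im_fun (fun y => Theta y A)) x)%C)) => A'.
  by have [d1 d2] := dTheta A'; split; apply/derivableP/diff_derivable.
have IIx := nbhs_singleton II; have JJx := nbhs_singleton JJ; have JIx := nbhs_singleton JI.
have gTx := nbhs_singleton gT; have gIx := nbhs_singleton gI; have gJx := nbhs_singleton gJ.
have XI j : X j *m I x = I x *m X j by case: (hGX j).
have XJ j : X j *m J x = J x *m X j by case: (hGX j).
have Xg j : X j *m g x = g x *m (X j)^T by case: (hGX j).
have trX : forall j, \tr (X j) = 0.
  apply: (trace_eq0_of_q0_form mq IIx JJx JIx XI XJ mlTheta alTheta tyTheta Theta_neq0) => B.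
  rewrite -[RHS](delbarTheta B); apply: eq_bigr => S _.
  by rewrite (extdE mlTheta Theta_inv) drop_sym.
have skew (E : 'M[R]_m) : E *m E = - 1%:M -> E *m g x *m E^T = g x -> (E *m g x)^T = - (E *m g x).
  by move=> EE Eg; rewrite trmx_mul gTx -[in RHS]Eg !mulmxA EE !mulNmx mul1mx opprK.
have KKx : K x *m K x = - 1%:M.
  rewrite -(nbhs_singleton KE) {1}JIx mulNmx -!mulmxA [J x *m (J x *m _)]mulmxA JJx.
  by rewrite mulNmx mul1mx mulmxN opprK IIx.
have gKx : K x *m g x *m (K x)^T = g x.
  rewrite -(nbhs_singleton KE) trmx_mul.
  have -> : J x *m I x *m g x *m ((I x)^T *m (J x)^T) = J x *m (I x *m g x *m (I x)^T) *m (J x)^T.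
    by rewrite !mulmxA.
  by rewrite gIx gJx.
have trF : forall v, \tr (comb (flip Xc) v) = 0.
  apply: (flip_trace_eq0_of_hkt IIx JJx JIx gTx gunit gIx gJx XI XJ Xg trX) => B.
  rewrite (nbhs_singleton KE) -[RHS](delOmega B); apply: eq_bigr => S _.
  have ml := bilinear_multilinear (W x).
  have al : alternating (bilinear_form (W x)).
    apply: bilinear_alternating; rewrite /W /hkt_matrix linearZ /= linearD /= linearZ /=.
    by rewrite -!cmxT !skew // !cmxN scalerN -opprD scalerN.
  by rewrite -[in RHS]/(W _) (extdE ml Omega_inv) drop_sym.
have mk : m = p.*2.+2 by rewrite mq qp doubleS.
have ml : multilinear (wedge_pow (bilinear_form (cmx (I x *m g x))) p).
  exact/wedge_pow_multilinear/bilinear_multilinear.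
rewrite (extdE ml (fun j => cder_wedge_pow (k := p) (omega_inv j))) drop_sym //; last first.
  exact: wedge_pow_alternating.
apply: (ext_wedge_pow_eq0 mk _ IIx gTx gunit gIx XI Xg) => //.
by rewrite double_gt0.
Qed.

End BalancedInChart.

(** * Homogeneity *)

Section Homogeneity.
Context {R : realType} {m : nat} {G : topGroupType} {T : topologicalType}.
Variables (X : manifold_on R m G) (Gamma : set G) (M : manifold_on R m T) (pi : G -> T).
Local Notation C := R[i].
Local Notation form := (Defs.form R m).

(* t and t' correspond through the zigzag of linear maps A, L, B: below, A and *)
(* B are the differentials of pi at two points of G, and L that of a left      *)
(* translation between them.                                                   *)
Definition related (k : tensor_kind R m) (A L B : 'M[R]_m) (t t' : value k) :=
  exists s s' : value k, [/\ pulled k A s t, pulled k L s s' & pulled k B s' t'].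

Lemma related_endo (A L B E E' : 'M[R]_m) : A \in unitmx ->
  @related (endo_kind R m) A L B E E' ->
  E *m (invmx A *m L *m B) = (invmx A *m L *m B) *m E'.
Proof.
move=> uA [S [S' /= [h1 h2 h3]]].
have -> : E *m (invmx A *m L *m B) = invmx A *m (A *m E *m invmx A) *m L *m B.
  by rewrite !mulmxA mulVmx // mul1mx.
rewrite -h1 mulmxK // -!mulmxA -h3 !mulmxA; congr (_ *m _).
by rewrite -!mulmxA h2.
Qed.

Lemma related_bilinear (A L B g g' : 'M[R]_m) : A \in unitmx ->
  @related (bilinear_kind R m) A L B g g' ->
  g = (invmx A *m L *m B) *m g' *m (invmx A *m L *m B)^T.
Proof.
move=> uA [S [S' /= [h1 h2 h3]]].
have -> : g = invmx A *m S *m (invmx A)^T.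
  by rewrite h1 !mulmxA mulVmx // mul1mx -mulmxA -trmx_mul mulVmx // trmx1 mulmx1.
by rewrite h2 h3 !trmx_mul !mulmxA.
Qed.

Lemma related_form k (A L B : 'M[R]_m) (a a' : form k) : A \in unitmx ->
  @related (form_kind R m k) A L B a a' ->
  forall D, a D = a' (D *m cmx (invmx A *m L *m B)).
Proof.
move=> uA [S [S' /= [h1 h2 h3]]] D.
have e : D *m cmx (invmx A) *m cmx A = D by rewrite -mulmxA -cmxM mulVmx // cmx1 mulmx1.
by rewrite -[in LHS]e -h1 h2 h3 !cmxM !mulmxA.
Qed.

Hypotheses (pi_surj : forall y, exists x, pi x = y) (pi_diffeo : local_diffeo X M pi).

Lemma invariant_homogeneous (c : chart M) x y : crng M c x -> crng M c y ->
  exists A L B : 'M[R]_m, A \in unitmx /\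
  forall (k : tensor_kind R m) (t : field k M), invariant_tensor X pi t ->
    related A L B (t c x) (t c y).
Proof.
move=> [p cp <-] [p' cp' <-].
have [a pa] := pi_surj p; have [b pb] := pi_surj p'.
have [ca cax] := dom_cover X a; have [cb cbx] := dom_cover X b.
pose h : G := (b * a^-1)%g.
have ha : (h * a)%g = b by rewrite /h -mulgA mulVg mulg1.
exists (tangent_map (X := X) (Y := M) pi ca c a),
  (tangent_map (X := X) (Y := X) (fun z => h * z)%g ca cb a),
  (tangent_map (X := X) (Y := M) pi cb c b).
split; first by apply: pi_diffeo.2 => //; rewrite pa.
move=> k t [_ [t' [_ linv] pull]].
exists (t' ca (crd X ca a)), (t' cb (crd X cb b)); split.
- by rewrite -pa; apply: pull; rewrite ?pa.
- by have := linv h a ca cb cax; rewrite ha; apply.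
- by rewrite -pb; apply: pull; rewrite ?pb.
Qed.

End Homogeneity.

Section GramIdentity.
Context {R : realType} {m : nat}.

Lemma posdef_unitmx (g : 'M[R]_m) :
  (forall v : 'rV[R]_m, v != 0 -> 0 < (v *m g *m v^T) ord0 ord0) -> g \in unitmx.
Proof.
move=> pos; rewrite -row_free_unit -kermx_eq0; apply/rowV0P => v /sub_kermxP vg.
apply/eqP; apply: contraT => /pos; by rewrite vg mul0mx mxE ltxx.
Qed.

(** The (q,0)-forms are a line: [a A] is [det (A *m F)] times [a E], and the Gram determinant is [d]
    times the product of two such determinants. Hence the constant is the square of [a E] over
    [d]. *)
Lemma q0_form_gram q (I J g : 'M[R]_m) (a : Defs.form R m q) :
  m = q.*2 -> I *m I = - 1%:M -> J *m J = - 1%:M -> J *m I = - (I *m J) ->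
  g \in unitmx -> I *m g *m I^T = g ->
  Defs.multilinear a -> Defs.alternating a -> (forall A, a A = type_part I q a A) ->
  exists c, forall A B, a A * a B = c * \det (A *m hkt_matrix J (J *m I) g *m B^T).
Proof.
move=> mq II JJ JI gu gI ml al ty.
have IIc : cmx I *m cmx I = - 1%:M by rewrite -cmxM II cmxN cmx1.
have JJc : cmx J *m cmx J = - 1%:M by rewrite -cmxM JJ cmxN cmx1.
have JIc : cmx J *m cmx I = - (cmx I *m cmx J) by rewrite -!cmxM JI cmxN.
have [E [F [FE EF]]] := p10_factor IIc JJc JIc mq.
have [||d d0 dE] := det_hkt_gram IIc JJc JIc _ _ (hkt_matrixE g JI) FE EF.
- by rewrite map_unitmx.
- by rewrite -cmxT -!cmxM gI.
exists (a E * a E / d) => A B; rewrite dE (type_q0_det ml al ty FE A) (type_q0_det ml al ty FE B).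
by field.
Qed.
End GramIdentity.

Theorem theorem5p5 (R : realType) (n : nat) (hn : (0 < n)%N)
  (G : topGroupType) (X : manifold_on R (4 * n) G) (Gamma : set G)
  (T : topologicalType) (M : manifold_on R (4 * n) T) (pi : G -> T)
  (I J K : field (endo_kind R (4 * n)) M) (g : field (bilinear_kind R (4 * n)) M)
  (Theta : field (form_kind R (4 * n) (2 * n)) M) :
  solvmanifold X Gamma M pi ->
  invariant_tensor X pi Theta ->
  holomorphic_canonical_section I Theta ->
  nowhere_vanishing Theta ->
  invariant_tensor X pi I -> invariant_tensor X pi J -> invariant_tensor X pi K -> invariant_tensor X pi g ->
  HKT I J K g ->
  balanced I (2 * n) g.
Proof.
move=> [_ _ _ _ [pi_surj _ pi_diffeo _]] invTheta [[[vTheta sTheta _] tyTheta] delbarTheta].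
move=> Theta_neq0 invI invJ invK invg.
move=> [[[[_ sI _] II nI] [[_ sJ _] JJ nJ] [[_ sK _] _ nK] KE anti]].
move=> [[_ sg _] gT gpos] [gI gJ _] delOmega c x cx.
have near_chart (P : 'rV[R]_(4 * n) -> Prop) : (forall y, crng M c y -> P y) ->
    \forall y \near x, P y.
  have Ux : nbhs x (crng M c) by apply: open_nbhs_nbhs; split=> //; exact: crng_open.
  by move=> h; apply: filterS Ux => y; apply: h.
have JI y : crng M c y -> J c y *m I c y = - (I c y *m J c y).
  by move=> cy; have [-> _ _] := anti c y cy; rewrite opprK.
have gunit y : crng M c y -> g c y \in unitmx by move=> cy; apply: posdef_unitmx (gpos c y cy).
have mq : (4 * n = (2 * n).*2)%N by rewrite -mul2n mulnA.
have qp : (2 * n = (2 * n).-1.+1)%N by rewrite prednK // muln_gt0.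
have diff (E : field (endo_kind R (4 * n)) M) :
    (forall c, smooth_expr (endo_kind R (4 * n)) (crng M c) (E c)) ->
    forall a b, differentiable (fun y => E c y a b) x.
  by move=> sE a b; apply: smooth_fun_differentiable (sE c a b) cx.
(* The constant is fixed at [x]; the last step of the proof shows that it serves at all points of
   the chart. *)
have [cst gram] : exists cst, forall A B, Theta c x A * Theta c x B =
    cst * \det (A *m hkt_matrix (J c x) (K c x) (g c x) *m B^T).
  rewrite -(KE c x cx); have [ml al] := vTheta c x cx.
  exact: (q0_form_gram mq (II c x cx) (JJ c x cx) (JI x cx) (gunit x cx) (gI c x cx) ml al
           (tyTheta c x cx)).
move=> A.
have [ml al] := vTheta c x cx.
apply: (@balanced_in_chart R (4 * n) (2 * n) (2 * n).-1 (I c) (J c) (K c) (g c) (Theta c) x mq qp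
  _ (diff _ sI) (diff _ sJ) (diff _ sK) (diff _ sg) _ _ _ _ _ _ _ _ _ _ _ _ ml al
  (tyTheta c x cx) (Theta_neq0 c x cx) (delbarTheta c x cx) (delOmega c x cx) cst).
- by move: hn; case: (n) => // n' _; rewrite mulnS.
- by move=> B; have [s1 s2] := sTheta c B; split; apply: smooth_fun_differentiable cx.
- by apply: near_chart => y; apply: II.
- by apply: near_chart => y; apply: JJ.
- by apply: near_chart => y; apply: KE.
- exact: near_chart.
- by apply: near_chart => y; apply: gT.
- by apply: near_chart => y; apply: gI.
- by apply: near_chart => y; apply: gJ.
- exact: nI.
- exact: nJ.
- exact: nK.
- exact: gunit.
(* A single linear map [P] carries the tensors at [x] to those at [y]; both sides of the Gram
   identity at [y] are those at [x] with [B] and [D] multiplied by [cmx P]. *)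
apply: near_chart => y cy B D.
have [L0 [L1 [L2 [uL rel]]]] := invariant_homogeneous pi_surj pi_diffeo cy cx.
pose P := invmx L0 *m L1 *m L2.
have gP := related_bilinear uL (rel _ _ invg).
have lower (E : field (endo_kind R (4 * n)) M) : invariant_tensor X pi E ->
    cmx (E c y *m g c y) = cmx P *m cmx (E c x *m g c x) *m (cmx P)^T.
  move=> /rel /(related_endo uL); rewrite -/P => EP; rewrite -cmxT -!cmxM; congr cmx.
  by rewrite {1}gP -/P -(mulmxA P (g c x) P^T) (mulmxA (E c y) P) EP !mulmxA.
rewrite !(related_form uL (rel _ _ invTheta)) -/P gram; congr (_ * \det _).
have -> : hkt_matrix (J c y) (K c y) (g c y)
    = cmx P *m hkt_matrix (J c x) (K c x) (g c x) *m (cmx P)^T.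
  rewrite /hkt_matrix !lower // -scalemxAr -scalemxAl mulmxDr mulmxDl.
  by rewrite -scalemxAr -scalemxAl.
by rewrite trmx_mul !mulmxA.
Qed.
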